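(* Under Assumptions 1–3 stated in the context, let $$\Theta^*=(\Gamma^*,\phi^* ):=\Big(\big(\Sigma_{\Psi,N}+\tfrac1n\Sigma_{\bar\beta,N}^{-1}\big)^{-1},\ \phi^*_{\underline N:\bar N}\Big).$$ Then $$\inf_{\Theta\in\mathcal S_N\times\mathcal F_N}R(\Theta)\le R(\Theta^* )\lesssim\frac{N^{2r}}n\log N+\frac{N^{4r}}{n^2}\log^2N+\frac Nn+N^{-2s}+N^2\delta_N^4+N^{2r+1}\delta_N^2 .$$
   Context: $\lesssim$ hides constants independent of $N,n,\delta_N$ (take $N\ge2$). Regression tasks: $\mathcal X\subseteq\mathbb R^d$ with probability distribution $P_{\mathcal X}$; $(\psi_j^\circ)_{j\ge1}\subset L^2(P_{\mathcal X})$ fixed; a random coefficient sequence $\beta\in\mathbb R^\infty$ with law $P_\beta$ defines $F_\beta^\circ=\sum_j\beta_j\psi_j^\circ$, and $\mathcal F^\circ=\{F_\beta^\circ:\beta\in\operatorname{supp}P_\beta\}$. A prompt consists of $\mathbf X=(x_1,\dots,x_n)$, $x_k$ i.i.d. $\sim P_{\mathcal X}$, $\mathbf y=(y_1,\dots,y_n)^\top$ with $y_k=F_\beta^\circ(x_k)+\xi_k$, where $\xi_k$ are i.i.d., mean zero, $|\xi_k|\le\sigma$ a.s., and an independent query $\tilde x\sim P_{\mathcal X}$. Assumption 1. For $N\in\mathbb N$ there exist integers $\underline N<\bar N\lesssim N$ with $\bar N-\underline N+1=N$ such that $\psi^\circ_{\underline N},\dots,\psi^\circ_{\bar N}$ are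 linearly independent and $\psi_1^\circ,\dots,\psi_{\underline N-1}^\circ$ lie in their linear span. Moreover there exist constants $r,C_1,C_2,C_\infty>0$ such that $\Sigma_{\Psi,N}:=(\mathbb E_{x\sim P_{\mathcal X}}[\psi_j^\circ(x)\psi_k^\circ(x)])_{j,k=\underline N}^{\bar N}$ satisfies $C_1\mathbf I_N\preceq\Sigma_{\Psi,N}\preceq C_2\mathbf I_N$ and $\|\sum_{j=\underline N}^{\bar N}(\psi_j^\circ)^2\|_{L^\infty(P_{\mathcal X})}^{1/2}\le C_\infty N^r$. Let $F^\circ_{\beta,M}=\sum_{j=1}^M\beta_j\psi_j^\circ$, and let $\bar\beta_{\underline N},\dots,\bar\beta_{\bar N}$ be the unique coefficients with $F^\circ_{\beta,\bar N}=\sum_{j=\underline N}^{\bar N}\bar\beta_j\psi_j^\circ$. Put $\Sigma_{\beta,\bar N}=(\mathbb E_\beta[\beta_j\beta_k])_{j,k=1}^{\bar N}$, $\Sigma_{\bar\beta,N}=(\mathbb E_\beta[\bar\beta_j\bar\beta_k])_{j,k=\underline N}^{\bar N}$. Assumption 2. For $s,B>0$: $\|F_\beta^\circ\|_{L^\infty(P_{\mathcal X})}\le B$ for all $F_\beta^\circ\in\mathcal F^\circ$; $\|F_\beta^\circ-F^\circ_{\beta,N}\|^2_{L^2(P_{\mathcal X})}\lesssim N^{-2s}$ uniformly over $\beta\in\operatorname{supp}P_\beta$; $\operatorname{Tr}(\Sigma_{\bar\beta,N})$ is bounded for all $N$; and $0\prec\Sigma_{\beta,\bar N}\precsim\operatorname{diag}[(j^{-2s-1}(\log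 j)^{-2})_{j=1}^{\bar N}]$ (no restriction at $j=1$ from the logarithm). Assumption 3. $\mathcal F_N$ is a class of maps $\phi:\mathcal X\to\mathbb R^N$ with $\|\phi(x)\|_2\le B_N'$ for some $B_N'>0$ and all $x\in\mathcal X$, $\phi\in\mathcal F_N$; and for some $\delta_N>0$ there is $\phi^*=\phi^*_{\underline N:\bar N}=(\phi^*_{\underline N},\dots,\phi^*_{\bar N})\in\mathcal F_N$ with $\max_{\underline N\le j\le\bar N}\|\psi_j^\circ-\phi_j^*\|_{L^\infty(P_{\mathcal X})}\le\delta_N$. Model: $\mathcal S_N=\{\Gamma\in\mathbb R^{N\times N}:0\preceq\Gamma\preceq C_3\mathbf I_N\}$ with a constant $C_3\ge C_1^{-1}$. For $\Theta=(\Gamma,\phi)\in\mathcal S_N\times\mathcal F_N$, $f_\Theta(\mathbf X,\mathbf y,\tilde x)=\mathrm{clip}_B(\frac1n\sum_{k=1}^ny_k\phi(x_k)^\top\Gamma^\top\phi(\tilde x))$, $\mathrm{clip}_B(u)=\max\{\min\{u,B\},-B\}$, and $R(\Theta)=\mathbb E_{\mathbf X,\mathbf y,\tilde x,\beta}[(F_\beta^\circ(\tilde x)-f_\Theta(\mathbf X,\mathbf y,\tilde x))^2]$. *)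

(* Defs.v *)
From HB Require Import structures.
From mathcomp Require Import all_boot all_order all_algebra.
From mathcomp Require Import all_classical all_reals all_analysis.

Set Implicit Arguments.
Unset Strict Implicit.
Unset Printing Implicit Defensive.
Import Order.TTheory GRing.Theory Num.Theory.
Import numFieldNormedType.Exports.

Local Open Scope classical_set_scope.
Local Open Scope ring_scope.

(* A subset [X] of R^d as a measurable space: [d.-tuple R] carries the Borel
   sigma-algebra of R^d, and [X] (not assumed Borel) its trace. Measurable types
   are pointed, hence the nonemptiness argument; it is no restriction, since [X]
   has to carry a probability. *)
Definition domain (R : realType) (d : nat) (X : set (d.-tuple R))
  (X0 : X !=set0) : Type := set_type X.

Section domain_measurable.
Context (R : realType) (d : nat) (X : set (d.-tuple R)) (X0 : X !=set0).

HB.instance Definition _ := Choice.copy (domain X0) (set_type X).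
HB.instance Definition _ := isPointed.Build (domain X0)
  (exist _ (xget point X) (mem_set (xgetPex point X0))).

Let incl : domain X0 -> d.-tuple R := set_val.

Let trace : set (set (domain X0)) := preimage_set_system setT incl measurable.

Let trace_sigma : sigma_algebra setT trace.
Proof. exact: sigma_algebra_preimage (sigma_algebra_measurable _). Qed.

Let trace0 : trace set0.
Proof. by have [] := trace_sigma. Qed.

Let traceC A : trace A -> trace (~` A).
Proof. by rewrite -setTD; have [_ h _] := trace_sigma; exact: h. Qed.

Let traceU (A : (set (domain X0))^nat) :
  (forall i, trace (A i)) -> trace (\bigcup_i A i).
Proof. by have [_ _] := trace_sigma; apply. Qed.

HB.instance Definition _ := @isMeasurable.Build (preimage_display incl)
  (domain X0) trace trace0 traceC traceU.

End domain_measurable.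

(* R^oo with the Borel sigma-algebra of the product topology. *)
Definition Rinfty (R : realType) : Type :=
  g_sigma_algebraType (@open {ptws nat -> R}).

HB.instance Definition _ (R : realType) := Measurable.on (Rinfty R).

Definition law_support (R : realType) (P : probability (Rinfty R) R) :
    set (Rinfty R) :=
  [set b | forall U : set {ptws nat -> R}, open U -> U b -> (0 < P U)%E].

Section iid.
Context (d : measure_display) (T : measurableType d) (R : realType).

Definition tuple_cons (n : nat) (p : T * n.-tuple T) : n.+1.-tuple T :=
  [tuple of p.1 :: p.2].

Let measurable_tuple_cons n : measurable_fun setT (@tuple_cons n).
Proof. exact: measurable_cons. Qed.

HB.instance Definition _ n :=
  isMeasurableFun.Build _ _ _ _ (@tuple_cons n) (@measurable_tuple_cons n).

(* The n-fold product measure, i.e. the law of an i.i.d. sample of size n. *)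
Fixpoint iid_law (P : probability T R) (n : nat) : probability (n.-tuple T) R :=
  match n with
  | 0 => \d_([tuple] : 0.-tuple T)
  | m.+1 => distribution (P \x iid_law P m)%E (@tuple_cons m)
  end.

Lemma iid_law_box (P : probability T R) n (A : 'I_n -> set T) :
  (forall i, measurable (A i)) ->
  iid_law P n [set t | forall i, A i (tnth t i)] = (\prod_(i < n) P (A i))%E.
Proof.
elim: n A => [|n IHn] A mA /=.
  rewrite big_ord0 diracE mem_set//= => i; by case: i.
rewrite /distribution /pushforward big_ord_recl -IHn//.
have mB : measurable [set t : n.-tuple T | forall i, A (lift ord0 i) (tnth t i)].
  have -> : [set t : n.-tuple T | forall i, A (lift ord0 i) (tnth t i)] =
      \bigcap_(i in [set: 'I_n])
        ((fun t : n.-tuple T => tnth t i) @^-1` A (lift ord0 i)).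
    by apply/seteqP; split => [t h i _|t h i]; apply: h.
  apply: fin_bigcap_measurable; first exact: finite_finset.
  by move=> i _; rewrite -[X in measurable X]setTI; exact: measurable_tnth.
rewrite -product_measure1E//; congr (product_measure1 _ _ _).
apply/seteqP; split => [[x t] /= h|[x t] /= [h0 h1] i].
- split; first exact: (h ord0).
  by move=> i; have := h (lift ord0 i); rewrite tnthS.
- have [j ->|->] := unliftP ord0 i; last exact: h0.
  by rewrite tnthS; exact: h1.
Qed.

End iid.

Section matrices.
Context (R : realType).

Definition quad n (A : 'M[R]_n) (v : 'cV[R]_n) : R := (v^T *m A *m v) 0 0.

Definition psdmx n (A : 'M[R]_n) : Prop :=
  A^T = A /\ forall v, 0 <= quad A v.

Definition pdmx n (A : 'M[R]_n) : Prop :=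
  A^T = A /\ forall v, v != 0 -> 0 < quad A v.

Definition loewner_le n (A B : 'M[R]_n) : Prop := psdmx (B - A).

Definition norm2 n (v : 'cV[R]_n) : R := Num.sqrt (\sum_(i < n) v i 0 ^+ 2).

Definition clip (B u : R) : R := Num.max (Num.min u B) (- B).

End matrices.

Section regression.
Context (R : realType) (d : nat) (X : set (d.-tuple R)) (X0 : X !=set0).
Context (PX : probability (domain X0) R) (Pbeta : probability (Rinfty R) R)
  (Pxi : probability R R).

(* Sequences are 0-based: [psi j] and [b j] stand for psi_(j+1) and beta_(j+1),
   so that [partial_sum psi M b] is F_(beta,M). *)
Implicit Types (psi : nat -> domain X0 -> R) (b : Rinfty R)
  (F : Rinfty R -> domain X0 -> R).

Definition partial_sum psi (M : nat) b (x : domain X0) : R :=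
  \sum_(j < M) b j * psi j x.

(* [lo] is the (1-based) index of the first function of the window. *)
Definition window psi (lo i : nat) : domain X0 -> R := psi (lo.-1 + i)%N.

Definition window_sum psi (lo N : nat) (c : 'cV[R]_N) (x : domain X0) : R :=
  \sum_(i < N) c i 0 * window psi lo i x.

(* The coefficients bar beta of F_(beta,hi) on the window. *)
Definition window_coef psi (lo hi N : nat) b : 'cV[R]_N :=
  xget 0 [set c | {ae PX, forall x,
    partial_sum psi hi b x = window_sum psi lo c x}].

Definition Sigma_Psi psi (lo N : nat) : 'M[R]_N :=
  \matrix_(i, j) \int[PX]_x (window psi lo i x * window psi lo j x).

Definition Sigma_beta (M : nat) : 'M[R]_M :=
  \matrix_(j, k) \int[Pbeta]_b (b j * b k).

Definition Sigma_bar psi (lo hi N : nat) : 'M[R]_N :=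
  \matrix_(i, j) \int[Pbeta]_b
    (window_coef psi lo hi N b i 0 * window_coef psi lo hi N b j 0).

(* [F b] is a representative, jointly measurable in [(b, x)], of the class of
   the L^2(PX)-convergent series sum_j beta_j psi_j. *)
Record regression_model psi F (sigma : R) : Prop := {
  psi_L2 : forall j, psi j \in Lfun PX 2%:E ;
  beta_L2 : forall j, (fun b : Rinfty R => b j) \in Lfun Pbeta 2%:E ;
  F_measurable :
    measurable_fun setT (fun p : Rinfty R * domain X0 => F p.1 p.2) ;
  F_series : forall b, law_support Pbeta b ->
    (fun M => 'N[PX]_2%:E[EFin \o (F b \- partial_sum psi M b)%R])%E
      @ \oo --> 0%E ;
  xi_mean0 : \int[Pxi]_e e = 0 ;
  xi_bounded : {ae Pxi, forall e, `|e| <= sigma}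
}.

Record assumption1 psi (lo hi : nat -> nat) (r C1 C2 Cinf : R) : Prop := {
  A1_constants : [/\ 0 < r, 0 < C1, 0 < C2 & 0 < Cinf] ;
  A1_window : forall N, (2 <= N)%N ->
    [/\ (1 <= lo N)%N, (lo N < hi N)%N & (hi N - lo N + 1 = N)%N] ;
  A1_hi : exists K : R, forall N, (2 <= N)%N -> (hi N)%:R <= K * N%:R ;
  A1_independent : forall N, (2 <= N)%N -> forall c : 'cV[R]_N,
    {ae PX, forall x, window_sum psi (lo N) c x = 0} -> c = 0 ;
  A1_span : forall N, (2 <= N)%N -> forall j, (j < (lo N).-1)%N ->
    exists c : 'cV[R]_N, {ae PX, forall x, psi j x = window_sum psi (lo N) c x} ;
  A1_Sigma : forall N, (2 <= N)%N ->
    loewner_le C1%:M (Sigma_Psi psi (lo N) N) /\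
    loewner_le (Sigma_Psi psi (lo N) N) C2%:M ;
  A1_sup : forall N, (2 <= N)%N ->
    ('N[PX]_(+oo)[(fun x => (\sum_(i < N) window psi (lo N) i x ^+ 2)%:E)] `^ 2^-1
      <= (Cinf * N%:R `^ r)%:E)%E
}.

(* The j-th entry is (j+1)^(-2s-1) (log (j+1))^(-2); it is infinite for j = 0,
   where the logarithm vanishes. *)
Definition decay (s : R) (j : nat) : \bar R :=
  if j == 0%N then +oo%E
  else (j.+1%:R `^ (- 2 * s - 1) * (ln j.+1%:R) ^- 2)%:E.

(* In [A2_decay] the Loewner bound by K diag(decay) is spelled out through
   quadratic forms, because the first diagonal entry is infinite
   (with +oo * 0 = 0). *)
Record assumption2 psi F (lo hi : nat -> nat) (s B : R) : Prop := {
  A2_constants : 0 < s /\ 0 < B ;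
  A2_bounded : forall b, law_support Pbeta b ->
    ('N[PX]_(+oo)[EFin \o F b] <= B%:E)%E ;
  A2_tail : exists K : R, forall N, (2 <= N)%N ->
    forall b, law_support Pbeta b ->
    ('N[PX]_2%:E[EFin \o (F b \- partial_sum psi N b)%R] ^+ 2
      <= (K * N%:R `^ (- 2 * s))%:E)%E ;
  A2_trace : exists K : R, forall N, (2 <= N)%N ->
    \tr (Sigma_bar psi (lo N) (hi N) N) <= K ;
  A2_pd : forall N, (2 <= N)%N -> pdmx (Sigma_beta (hi N)) ;
  A2_decay : exists2 K : R, 0 < K & forall N, (2 <= N)%N ->
    forall v : 'cV[R]_(hi N),
    ((quad (Sigma_beta (hi N)) v)%:E
      <= K%:E * \sum_(j < hi N) decay s j * (v j 0 ^+ 2)%:E)%E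
}.

Record assumption3 psi (lo N : nat) (FN : set (domain X0 -> 'cV[R]_N))
    (B' delta : R) (phi : domain X0 -> 'cV[R]_N) : Prop := {
  A3_constants : 0 < B' /\ 0 < delta ;
  A3_measurable : forall f, FN f ->
    forall i, measurable_fun setT (fun x => f x i 0) ;
  A3_bounded : forall f, FN f -> forall x, norm2 (f x) <= B' ;
  A3_mem : FN phi ;
  A3_approx : forall i : 'I_N,
    ('N[PX]_(+oo)[(fun x => (window psi lo i x - phi x i 0)%:E)] <= delta%:E)%E
}.

Definition Gamma_class (C3 : R) (N : nat) : set 'M[R]_N :=
  [set G | loewner_le 0 G /\ loewner_le G C3%:M].

Definition responses F b n (xs : n.-tuple (domain X0)) (xi : n.-tuple R) :
    n.-tuple R :=
  [tuple F b (tnth xs k) + tnth xi k | k < n].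

Definition predictor (B : R) N (Theta : 'M[R]_N * (domain X0 -> 'cV[R]_N)) n
    (xs : n.-tuple (domain X0)) (ys : n.-tuple R) (x : domain X0) : R :=
  clip B (n%:R^-1 * \sum_(k < n)
    tnth ys k * ((Theta.2 (tnth xs k))^T *m Theta.1^T *m Theta.2 x) 0 0).

(* beta, the prompt inputs, the noise and the query are independent, so the
   expectation is an iterated integral against their laws. *)
Definition risk F (B : R) N (n : nat)
    (Theta : 'M[R]_N * (domain X0 -> 'cV[R]_N)) : \bar R :=
  (\int[Pbeta]_b \int[iid_law PX n]_xs \int[iid_law Pxi n]_xi \int[PX]_x
    ((F b x - predictor B Theta xs (responses F b xs xi) x) ^+ 2)%:E)%E.

Definition Gamma_star psi (lo hi N n : nat) : 'M[R]_N :=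
  invmx (Sigma_Psi psi lo N + n%:R^-1 *: invmx (Sigma_bar psi lo hi N)).

End regression.

Arguments Gamma_class {R} C3 N _.

(* Main.v *)
(* Gamma_star does not depend on the prompt, so a second-moment computation
   suffices: no matrix concentration is needed, and the two logarithmic terms do
   not even appear. Write phi_star = psi + e on the window. Since
   |F| <= B, removing the clipping increases the risk. Given beta, the unclipped
   predictor is an average of n independent terms, hence its risk is at most the
   squared bias plus (B^2 + sigma^2)/n times the second moment of one kernel
   value phi(x')^T Gamma phi(x).
   With c = bar beta, g the tail of the series, S = Sigma_Psi and
   G = (S + K/n)^-1, K = Sigma_bar^-1, the bias is the sum of
     psi^T (1 - G S) c,  g,  - (E[g psi] + E[F e])^T G psi,  - E[F phi]^T G e.
   Averaged over beta, the first one contributes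
   (tr (G S) - tr (G S G S))/n <= N/n; the others are controlled by
   S <= C2, |G v| <= |v|/C1, |e|^2 <= N delta^2 and Bessel's inequality. In the
   second moment of the kernel, sup |psi|^2 <= Cinf^2 N^(2r) is used only for the
   part of phi(x') coming from e, which yields N^(2r+1) delta^2. *)

Require Import Defs.
From mathcomp Require Import all_boot all_order all_algebra.
From mathcomp Require Import all_classical all_reals all_analysis.
From mathcomp Require Import measurable_realfun ess_sup_inf.
From mathcomp Require Import ring lra zify.
Import Order.TTheory GRing.Theory Num.Theory.
Import numFieldNormedType.Exports.
Local Open Scope classical_set_scope.
Local Open Scope ring_scope.

Set Implicit Arguments.
Unset Strict Implicit.
Unset Printing Implicit Defensive.

(** * Expectations of essentially bounded functions under a probability *)

Section ess_bounded.
Context d (T : measurableType d) (R : realType) (P : probability T R).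
Implicit Types f g : T -> R.

(** A class of integrable functions closed under ring operations, so that linearity of the
    expectation leaves only closure goals as side conditions. *)
Definition ess_bounded f : Prop :=
  measurable_fun setT f /\ exists K : R, {ae P, forall x, `|f x| <= K}.

Lemma ess_bounded_cst c : ess_bounded (fun=> c).
Proof. by split; [exact: measurable_cst|exists `|c|; exact: aeW]. Qed.

Lemma ess_boundedD f g :
  ess_bounded f -> ess_bounded g -> ess_bounded (fun x => f x + g x).
Proof.
move=> [mf [K hK]] [mg [L hL]]; split; first exact: measurable_funD.
exists (K + L); apply: filterS2 hK hL => x fK gL.
exact: le_trans (ler_normD _ _) (lerD fK gL).
Qed.

Lemma ess_boundedM f g :
  ess_bounded f -> ess_bounded g -> ess_bounded (fun x => f x * g x).
Proof.
move=> [mf [K hK]] [mg [L hL]]; split; first exact: measurable_funM.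
exists (K * L); apply: filterS2 hK hL => x fK gL.
by rewrite normrM ler_pM.
Qed.

Lemma ess_boundedN f : ess_bounded f -> ess_bounded (fun x => - f x).
Proof.
move=> [mf [K hK]]; split; first exact: measurableT_comp.
by exists K; apply: filterS hK => x; rewrite normrN.
Qed.

Lemma ess_boundedB f g :
  ess_bounded f -> ess_bounded g -> ess_bounded (fun x => f x - g x).
Proof. by move=> bf /ess_boundedN; exact: ess_boundedD. Qed.

Lemma ess_bounded_sqr f : ess_bounded f -> ess_bounded (fun x => f x ^+ 2).
Proof.
move=> bf; have := ess_boundedM bf bf.
by under eq_fun do rewrite -expr2.
Qed.

Lemma ess_bounded_sum I (s : seq I) (h : I -> T -> R) :
  (forall i, ess_bounded (h i)) -> ess_bounded (fun x => \sum_(i <- s) h i x).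
Proof.
move=> bh; elim: s => [|i s IHs].
  by under eq_fun do rewrite big_nil; exact: ess_bounded_cst.
by under eq_fun do rewrite big_cons; exact: ess_boundedD.
Qed.

Lemma ess_bounded_integrable f : ess_bounded f -> P.-integrable setT (EFin \o f).
Proof.
move=> [mf [K hK]]; apply/integrableP; split; first exact/measurable_EFinP.
apply: (@le_lt_trans _ _ (\int[P]_x (`|K|%:E))%E).
  apply: ae_ge0_le_integral => //.
  - by apply: measurableT_comp => //; exact/measurable_EFinP.
  - apply: filterS hK => x fK _ /=; rewrite lee_fin.
    exact: le_trans fK (ler_norm _).
rewrite integral_cst//=.
by rewrite probability_setT mule1 ltry.
Qed.

Lemma EFin_Rintegral f : ess_bounded f ->
  (\int[P]_x (f x)%:E)%E = (\int[P]_x f x)%:E.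
Proof.
by move=> bf; rewrite fineK// integrable_fin_num//; exact: ess_bounded_integrable.
Qed.

Lemma expectD f g : ess_bounded f -> ess_bounded g ->
  \int[P]_x (f x + g x) = \int[P]_x f x + \int[P]_x g x.
Proof. by move=> bf bg; rewrite RintegralD//; exact: ess_bounded_integrable. Qed.

Lemma expectZ c f : ess_bounded f ->
  \int[P]_x (c * f x) = c * \int[P]_x f x.
Proof. by move=> bf; rewrite RintegralZl//; exact: ess_bounded_integrable. Qed.

Lemma expectB f g : ess_bounded f -> ess_bounded g ->
  \int[P]_x (f x - g x) = \int[P]_x f x - \int[P]_x g x.
Proof. by move=> bf bg; rewrite RintegralB//; exact: ess_bounded_integrable. Qed.

Lemma expect_cst c : \int[P]_x c = c.
Proof. by rewrite Rintegral_cst//= probability_setT mulr1. Qed.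

Lemma expect_sum I (s : seq I) (h : I -> T -> R) :
  (forall i, ess_bounded (h i)) ->
  \int[P]_x (\sum_(i <- s) h i x) = \sum_(i <- s) \int[P]_x h i x.
Proof.
move=> bh; elim: s => [|i s IHs].
  by under eq_Rintegral do rewrite big_nil; rewrite expect_cst big_nil.
under eq_Rintegral do rewrite big_cons.
by rewrite expectD ?big_cons ?IHs//; exact: ess_bounded_sum.
Qed.

Lemma le_expect f g : ess_bounded f -> ess_bounded g ->
  {ae P, forall x, f x <= g x} -> \int[P]_x f x <= \int[P]_x g x.
Proof.
move=> bf bg fg; rewrite -subr_ge0 -expectB//.
have bh := ess_boundedB bg bf.
rewrite -lee_fin -EFin_Rintegral//.
(* The difference agrees almost everywhere with its positive part, which is nonnegative at every
   point. *)
rewrite (@ae_eq_integral _ _ _ _ _ (fun x => (Num.max (g x - f x) 0)%:E))//.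
- by apply: integral_ge0 => x _; rewrite lee_fin le_max lexx orbT.
- by apply/measurable_EFinP; exact: bh.1.
- apply/measurable_EFinP; apply: measurable_maxr => //; exact: bh.1.
- by apply: filterS fg => x fg _ /=; rewrite max_l// subr_ge0.
Qed.

Lemma expect_ge0 f : (forall x, 0 <= f x) -> 0 <= \int[P]_x f x.
Proof. by move=> f0; exact: Rintegral_ge0. Qed.

Lemma le_expect_cst f c : ess_bounded f -> {ae P, forall x, f x <= c} ->
  \int[P]_x f x <= c.
Proof.
by move=> bf fc; rewrite -[leRHS]expect_cst le_expect//; exact: ess_bounded_cst.
Qed.

End ess_bounded.

(** * Monotone integrals of possibly nonmeasurable functions *)

Import HBNNSimple.

(** The integral of a nonnegative function is the supremum over the simple functions below it,
    whether or not it is measurable. Iterated integrals can thus be bounded from the inside without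
    proving the inner integrals measurable. *)
Lemma le_integral_nonmeasurable d (T : measurableType d) (R : realType)
    (mu : {measure set T -> \bar R}) (f g : T -> \bar R) :
  (forall x, 0 <= f x)%E -> (forall x, f x <= g x)%E ->
  (\int[mu]_x f x <= \int[mu]_x g x)%E.
Proof.
move=> f0 fg; rewrite !ge0_integralTE//; last first.
  by move=> x; exact: le_trans (f0 x) (fg x).
apply: ereal_sup_le => _ [h hf <-]; exists h => // x.
exact: le_trans (hf x) (fg x).
Qed.

(* No measurability of [f] is needed: [g] is replaced by [+oo] on a null set. *)
Lemma ae_le_integral_nonmeasurable d (T : measurableType d) (R : realType)
    (mu : {measure set T -> \bar R}) (f g : T -> \bar R) :
  (forall x, 0 <= f x)%E -> (forall x, 0 <= g x)%E -> measurable_fun setT g ->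
  {ae mu, forall x, (f x <= g x)%E} ->
  (\int[mu]_x f x <= \int[mu]_x g x)%E.
Proof.
move=> f0 g0 mg [A [mA A0 sA]].
pose g' x := if x \in A then +oo%E else g x.
have mg' : measurable_fun setT g'.
  apply: measurable_fun_ifT => //.
  by apply: (measurable_fun_bool true); rewrite setTI preimage_mem_true.
have -> : (\int[mu]_x g x = \int[mu]_x g' x)%E.
  apply: ge0_ae_eq_integral => //.
  - by move=> x _; rewrite /g'; case: ifP.
  - exists A; split=> // x /= h; apply: contrapT => nA; apply: h => _.
    by rewrite /g' memNset.
apply: le_integral_nonmeasurable => // x; rewrite /g'.
case: ifPn => [_|]; first by rewrite leey.
rewrite notin_setE => nA; apply: contrapT => h; apply: nA; exact: sA.
Qed.

(** * Second moments of sums over an i.i.d. sample *)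

Section iid_moments.
Context d (T : measurableType d) (R : realType) (Q : probability T R).

Lemma measurable_sum_tnth n (h : 'I_n -> T -> R) :
  (forall k, measurable_fun setT (h k)) ->
  measurable_fun setT (fun t : n.-tuple T => \sum_(k < n) h k (tnth t k)).
Proof.
move=> mh; apply: measurable_sum => k.
by apply: measurableT_comp => //; exact: measurable_tnth.
Qed.

Lemma measurable_tnth_fst d' (U : measurableType d') n (k : 'I_n) :
  measurable_fun setT (fun z : n.-tuple T * U => tnth z.1 k).
Proof. exact: measurableT_comp (measurable_tnth k) measurable_fst. Qed.

(* The variances of independent summands add up, and each is at most a second
   moment. *)
Lemma iid_second_moment_le n (g p : 'I_n -> T -> R) (c K : R) :
  (forall k, ess_bounded Q (g k)) -> (forall k, ess_bounded Q (p k)) ->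
  (forall k x, 0 <= p k x) -> 0 <= K ->
  (\int[iid_law Q n]_t ((c - \sum_(k < n) g k (tnth t k)) ^+ 2
      + (\sum_(k < n) p k (tnth t k) + K))%:E
   <= ((c - \sum_(k < n) \int[Q]_x g k x) ^+ 2
      + (\sum_(k < n) (\int[Q]_x (g k x ^+ 2) + \int[Q]_x p k x) + K))%:E)%E.
Proof.
elim: n g p c K => [|n IHn] g p c K bg bp p0 K0.
  under eq_integral do rewrite !big_ord0.
  by rewrite !big_ord0 integral_cst//= probability_setT mule1.
have mF : measurable_fun setT (fun t : n.+1.-tuple T =>
    ((c - \sum_(k < n.+1) g k (tnth t k)) ^+ 2
      + (\sum_(k < n.+1) p k (tnth t k) + K))%:E).
  apply/measurable_EFinP; apply: measurable_funD.
    apply: measurable_funX; apply: measurable_funB => //.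
    by apply: measurable_sum_tnth => k; case: (bg k).
  apply: measurable_funD => //.
  by apply: measurable_sum_tnth => k; case: (bp k).
have F0 (t : n.+1.-tuple T) : (0 <= ((c - \sum_(k < n.+1) g k (tnth t k)) ^+ 2
      + (\sum_(k < n.+1) p k (tnth t k) + K))%:E)%E.
  by rewrite lee_fin addr_ge0 ?sqr_ge0// addr_ge0// sumr_ge0.
have mcons : measurable_fun setT (@tuple_cons _ T n) by exact: measurable_cons.
rewrite /= ge0_integral_pushforward//=.
rewrite preimage_setT fubini_tonelli1//=; last first.
  exact: (measurableT_comp mF mcons).
pose mu' := \sum_(k < n) \int[Q]_x g (lift ord0 k) x.
pose V := \sum_(k < n) (\int[Q]_x (g (lift ord0 k) x ^+ 2)
  + \int[Q]_x p (lift ord0 k) x).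
have bg' k : ess_bounded Q (g (lift ord0 k)) by [].
have bp' k : ess_bounded Q (p (lift ord0 k)) by [].
apply: (@le_trans _ _ (\int[Q]_x
    (((c - mu') - g ord0 x) ^+ 2 + (p ord0 x + (V + K)))%:E)%E).
  apply: le_integral_nonmeasurable => x; first exact: integral_ge0.
  (* For a fixed first entry [x], that entry moves into the parameters: [c] absorbs [g ord0 x] and
     [K] absorbs [p ord0 x]. This is why the statement carries both. *)
  have H := IHn _ _ (c - g ord0 x) (p ord0 x + K) bg' bp'
    (fun k => p0 (lift ord0 k)) (addr_ge0 (p0 ord0 x) K0).
  refine (le_trans _ (le_trans H _)).
  - rewrite le_eqVlt; apply/orP; left; apply/eqP.
    apply: eq_integral => t _; rewrite !big_ord_recl.
    have e (h : 'I_n.+1 -> T -> R) :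
        \sum_(k < n) h (lift ord0 k) (tnth (tuple_cons (x, t)) (lift ord0 k)) =
        \sum_(k < n) h (lift ord0 k) (tnth t k).
      by apply: eq_bigr => k _; rewrite tnthS.
    by rewrite !e; congr EFin; rewrite /tuple_cons/= tnth0; ring.
  - by rewrite lee_fin -/mu' -/V addrAC (addrCA V).
rewrite EFin_Rintegral; last first.
  apply: ess_boundedD; last exact/ess_boundedD/ess_bounded_cst.
  exact/ess_bounded_sqr/ess_boundedB/bg/ess_bounded_cst.
rewrite lee_fin !big_ord_recl -/mu' -/V.
set a := c - mu'.
have bg0 := bg ord0; have bg2 := ess_bounded_sqr bg0.
have bag := ess_boundedM (ess_bounded_cst Q (2 * a)) bg0.
rewrite expectD; last 2 first.
  exact/ess_bounded_sqr/ess_boundedB/bg/ess_bounded_cst.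
  exact/ess_boundedD/ess_bounded_cst/bp.
rewrite expectD ?expect_cst//; last exact: ess_bounded_cst.
have -> : \int[Q]_x ((a - g ord0 x) ^+ 2) =
    a ^+ 2 - 2 * a * \int[Q]_x g ord0 x + \int[Q]_x (g ord0 x ^+ 2).
  under eq_Rintegral do rewrite sqrrB -mulrnAl -(mulr_natl a).
  rewrite expectD//; last exact/ess_boundedB/bag/ess_bounded_cst.
  by rewrite expectB// ?expect_cst ?expectZ//; exact: ess_bounded_cst.
(* The two sides differ exactly by the squared mean of [g ord0], which completes the square on the
   right. *)
by rewrite /a; have := sqr_ge0 (\int[Q]_x g ord0 x); nra.
Qed.

End iid_moments.

(** * Averaging over the prompt: noise first, then inputs *)

Section prompt_risk.
Context d (T : measurableType d) (R : realType).
Context (P : probability T R) (Pxi : probability R R).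

(** The second-moment bound is applied twice. For fixed inputs and query, the centred noise adds at
    most [sigma ^+ 2 * (h / n) ^+ 2] per summand; for a fixed query, the inputs then give the
    squared bias plus n second moments, each of weight 1/n^2. Tonelli moves the query integral
    outside before each application. *)
Lemma prompt_risk_le n (f : T -> R) (h : T -> T -> R) (B sigma H : R) :
  (0 < n)%N -> measurable_fun setT f -> {ae P, forall x, `|f x| <= B} ->
  measurable_fun setT (fun z : T * T => h z.1 z.2) ->
  (forall x' x, `|h x' x| <= H) ->
  \int[Pxi]_e e = 0 -> {ae Pxi, forall e, `|e| <= sigma} ->
  (\int[iid_law P n]_xs \int[iid_law Pxi n]_xi \int[P]_x
     ((f x - n%:R^-1 * \sum_(k < n)
         (f (tnth xs k) + tnth xi k) * h (tnth xs k) x) ^+ 2)%:E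
   <= \int[P]_x ((f x - \int[P]_x' (f x' * h x' x)) ^+ 2
        + (B ^+ 2 + sigma ^+ 2) / n%:R * \int[P]_x' (h x' x ^+ 2))%:E)%E.
Proof.
move=> n0 mf fB mh hH mean0 sig.
have n0R : (n%:R : R) != 0 by rewrite pnatr_eq0 -lt0n.
have mhk k : measurable_fun setT
    (fun z : n.-tuple T * T => h (tnth z.1 k) z.2).
  apply: (measurableT_comp mh (g := fun z : n.-tuple T * T => (tnth z.1 k, z.2))).
  by apply: measurable_fun_pair => //=; exact: measurable_tnth_fst.
have bh x : ess_bounded P (h ^~ x).
  split; last by exists H; exact: aeW.
  exact: (measurableT_comp mh (pair2_measurable x)).
have bf : ess_bounded P f by split=> //; exists B.
have bxi : ess_bounded Pxi (fun e => e) by split=> //; exists sigma.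
(* What is left once the noise is integrated out. The trailing 0 is the parameter [K] of
   [iid_second_moment_le]. *)
pose G (z : n.-tuple T * T) := (f z.2 - \sum_(k < n)
    f (tnth z.1 k) * h (tnth z.1 k) z.2 / n%:R) ^+ 2
  + (\sum_(k < n) sigma ^+ 2 * (h (tnth z.1 k) z.2 / n%:R) ^+ 2 + 0).
apply: (@le_trans _ _ (\int[iid_law P n]_xs \int[P]_x (G (xs, x))%:E)%E).
  apply: le_integral_nonmeasurable => xs.
    by apply: integral_ge0 => xi _; apply: integral_ge0 => x _;
      rewrite lee_fin sqr_ge0.
  pose F (z : n.-tuple R * T) := ((f z.2 - n%:R^-1 * \sum_(k < n)
         (f (tnth xs k) + tnth z.1 k) * h (tnth xs k) z.2) ^+ 2)%:E.
  rewrite (_ : (\int[_]_xi _)%E =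
    (\int[iid_law Pxi n]_xi \int[P]_x F (xi, x))%E)//.
  rewrite fubini_tonelli; last 2 first.
  - apply/measurable_EFinP/measurable_funX/measurable_funB.
      exact: measurableT_comp.
    apply: measurable_funM => //; apply: measurable_sum => k.
    apply: measurable_funM.
      by apply: measurable_funD => //; exact: measurable_tnth_fst.
    apply: (measurableT_comp mh (g := fun z : n.-tuple R * T => (tnth xs k, z.2))).
    exact: measurable_fun_pair.
  - by move=> z; rewrite lee_fin sqr_ge0.
  apply: le_integral_nonmeasurable => x.
    by apply: integral_ge0 => xi _; rewrite lee_fin sqr_ge0.
  pose c := f x - \sum_(k < n) f (tnth xs k) * h (tnth xs k) x / n%:R.
  pose a k := h (tnth xs k) x / n%:R.
  have ba k : ess_bounded Pxi (fun e => a k * e).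
    by apply: ess_boundedM => //; exact: ess_bounded_cst.
  have := @iid_second_moment_le _ _ _ Pxi n (fun k e => a k * e)
    (fun _ _ => 0) c 0 ba (fun=> ess_bounded_cst _ 0) (fun _ _ => lexx _) (lexx _).
  refine (fun le => le_trans _ (le_trans le _)).
    rewrite le_eqVlt; apply/orP; left; apply/eqP.
    apply: eq_integral => xi _; rewrite /F/=; congr EFin.
    rewrite big1_eq !addr0; congr (_ ^+ 2).
    rewrite /c -addrA -opprD; congr (_ - _).
    rewrite mulr_sumr -big_split/=; apply: eq_bigr => k _.
    by rewrite /a; field.
  rewrite lee_fin /G/= -/c [X in c - X]big1 ?subr0; last first.
    move=> k _; have -> : \int[Pxi]_e (a k * e) = a k * \int[Pxi]_e e.
      exact: (expectZ (a k) bxi).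
    by rewrite mean0 mulr0.
  rewrite lerD2l !addr0; apply: ler_sum => k _.
  rewrite expect_cst addr0 -/(a k).
  apply: le_expect_cst; first exact: ess_bounded_sqr.
  apply: filterS sig => e es; rewrite exprMn mulrC ler_wpM2r ?sqr_ge0//.
  by rewrite -[leLHS]real_normK ?num_real// lerXn2r ?nnegrE// (le_trans _ es).
rewrite (fubini_tonelli (EFin \o G)); last 2 first.
- apply/measurable_EFinP/measurable_funD.
    apply/measurable_funX/measurable_funB; first exact: measurableT_comp.
    apply: measurable_sum => k; apply: measurable_funM => //.
    apply: measurable_funM => //; apply: measurableT_comp => //.
    exact: measurable_tnth_fst.
  apply: measurable_funD => //; apply: measurable_sum => k.
  by apply: measurable_funM => //; apply: measurable_funX; exact: measurable_funM.
- move=> z; rewrite lee_fin addr_ge0 ?sqr_ge0// addr0 sumr_ge0// => k _.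
  by rewrite mulr_ge0 ?sqr_ge0.
apply: le_integral_nonmeasurable => x.
  apply: integral_ge0 => xs _.
  rewrite lee_fin addr_ge0 ?sqr_ge0// addr0 sumr_ge0// => k _.
  by rewrite mulr_ge0 ?sqr_ge0.
have bg : ess_bounded P (fun x' => f x' * h x' x / n%:R).
  by apply: ess_boundedM; [exact: ess_boundedM|exact: ess_bounded_cst].
have bh2 : ess_bounded P (fun x' => h x' x ^+ 2) by exact: ess_bounded_sqr.
have bp : ess_bounded P (fun x' => sigma ^+ 2 * (h x' x / n%:R) ^+ 2).
  apply: ess_boundedM; first exact: ess_bounded_cst.
  by apply/ess_bounded_sqr/ess_boundedM => //; exact: ess_bounded_cst.
have p0 (k : 'I_n) x' : 0 <= sigma ^+ 2 * (h x' x / n%:R) ^+ 2.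
  by rewrite mulr_ge0 ?sqr_ge0.
(* The noise variance enters as the nonnegative summand [p]. *)
apply: (le_trans (@iid_second_moment_le _ _ _ P n
    (fun _ x' => f x' * h x' x / n%:R)
    (fun _ x' => sigma ^+ 2 * (h x' x / n%:R) ^+ 2) (f x) 0
    (fun=> bg) (fun=> bp) p0 (lexx _))).
have nE (u : R) : \sum_(k < n) u / n%:R = u.
  by rewrite sumr_const card_ord -(mulr_natr (u / n%:R)) divfK.
rewrite lee_fin addr0 lerD//.
  rewrite (_ : \int[P]_x' (f x' * h x' x / n%:R) =
    (\int[P]_x' (f x' * h x' x)) / n%:R) ?nE//.
  under eq_Rintegral do rewrite mulrC.
  by rewrite expectZ 1?mulrC//; exact: ess_boundedM.
rewrite -[leRHS]nE; apply: ler_sum => k _.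
rewrite -expectD//; last exact: ess_bounded_sqr.
rewrite mulrAC -(expectZ ((B ^+ 2 + sigma ^+ 2) / n%:R / n%:R) bh2).
apply: le_expect; first by apply: ess_boundedD => //; exact: ess_bounded_sqr.
  by apply: ess_boundedM => //; exact: ess_bounded_cst.
apply: filterS fB => x' fB.
have : f x' ^+ 2 <= B ^+ 2.
  by rewrite -[leLHS]real_normK ?num_real// lerXn2r ?nnegrE// (le_trans _ fB).
move=> fB2.
have -> : (f x' * h x' x / n%:R) ^+ 2 + sigma ^+ 2 * (h x' x / n%:R) ^+ 2 =
    (f x' ^+ 2 + sigma ^+ 2) * (h x' x / n%:R) ^+ 2 by field.
have -> : (B ^+ 2 + sigma ^+ 2) / n%:R / n%:R * h x' x ^+ 2 =
    (B ^+ 2 + sigma ^+ 2) * (h x' x / n%:R) ^+ 2 by field.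
by rewrite ler_wpM2r ?lerD2r ?sqr_ge0.
Qed.

End prompt_risk.

(** * A law on R^oo gives full mass to its support *)

Section law_support_full.
Context (R : realType).

(** Open cylinders with rational bounds: a base of the product topology, countable because its
    members are indexed by finite lists. *)
Definition rational_box (s : seq (nat * rat * rat)) : set (nat -> R) :=
  [set c | all (fun t => ratr t.1.2 < c t.1.1 < ratr t.2) s].

(** The boxes around [b] generate a filter that converges to [b] in each coordinate, hence in the
    product topology, so it contains [U]. *)
Lemma rational_box_nbhs (U : set {ptws nat -> R}) (b : {ptws nat -> R}) :
  open U -> U b -> exists2 s, rational_box s b & rational_box s `<=` U.
Proof.
move=> oU Ub.
pose F := filter_from [set s | rational_box s b] rational_box.
have FF : Filter F.
  apply: filter_from_filter; first by exists [::].
  move=> s t sb tb; exists (s ++ t) => [|c]; rewrite /rational_box/= all_cat.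
    by rewrite sb tb.
  by move=> /andP.
have Fb : {ptws, F --> b}.
  apply/pointwise_cvgP => i A /= [e /= e0 eA].
  have [q qb] : exists q : rat, ratr q \in `](b i - e), (b i)[.
    have : b i - e < b i by rewrite gtrDl oppr_lt0.
    by move=> /rat_in_itvoo[q qb]; exists q.
  have [r rb] : exists r : rat, ratr r \in `](b i), (b i + e)[.
    have : b i < b i + e by rewrite ltrDl.
    by move=> /rat_in_itvoo[r rb]; exists r.
  move: qb rb; rewrite !in_itv/= => /andP[q1 q2] /andP[r1 r2].
  exists [:: (i, q, r)]; first by rewrite /rational_box/= q2 r1.
  move=> c /=; rewrite /rational_box/= andbT => /andP[qc cr].
  by apply: eA; rewrite /ball/= ltr_distlC; lra.
have [s sb sU] := Fb U (open_nbhs_nbhs (conj oU Ub)).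
by exists s.
Qed.

(** A point outside the support has a null open neighbourhood, hence lies in a null rational box,
    and there are countably many boxes. Measurable coordinates make the boxes events. *)
Lemma law_support_ae (P : probability (Rinfty R) R) :
  (forall j, measurable_fun setT (fun b : Rinfty R => b j)) ->
  {ae P, forall b, law_support P b}.
Proof.
move=> mcoord.
have mbox s : measurable (rational_box s : set (Rinfty R)).
  elim: s => [|[[i q] r] s IHs].
    rewrite [X in measurable X](_ : _ = setT); first exact: measurableT.
    by apply/seteqP; split.
  rewrite [X in measurable X](_ : _ = [set b : Rinfty R | ratr q < b i < ratr r]
    `&` (rational_box s : set (Rinfty R))); last first.
    by apply/seteqP; split=> b /=; [move=> /andP|move=> [h1 h2]; apply/andP].
  apply: measurableI => //.
  have := mcoord i measurableT `](ratr q), (ratr r)[%classic (measurable_itv _).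
  rewrite setTI [X in measurable X -> _](_ : _ =
    [set b : Rinfty R | ratr q < b i < ratr r])//.
(* The null boxes, enumerated by the codes of their lists; a code of no list or of a box of positive
   mass gives the empty set. *)
pose N k : set (Rinfty R) :=
  if unpickle k is Some s then
    if P (rational_box s) == 0%E then rational_box s else set0
  else set0.
have : P.-negligible (\bigcup_k N k).
  apply: negligible_bigcup => k; rewrite /N.
  case: unpickle => [s|]; last exact: negligible_set0.
  by case: eqP => [Ps|_]; [apply/negligibleP|exact: negligible_set0].
apply: negligibleS => b /= nb.
have [U [oU Ub PU]] : exists U : set {ptws nat -> R},
    [/\ open U, U b & ~ (0 < P U)%E].
  apply: contrapT => h; apply: nb => U oU Ub; apply: contrapT => PU.
  by apply: h; exists U.
have [s sb sU] := rational_box_nbhs oU Ub.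
exists (pickle s) => //; rewrite /N pickleK.
case: eqP => // Ps; exfalso; apply: PU.
apply: (@lt_le_trans _ _ (P (rational_box s))).
  by rewrite lt_neqAle eq_sym measure_ge0 andbT; apply/eqP.
apply: le_measure => //; rewrite inE//.
exact: sub_sigma_algebra.
Qed.

End law_support_full.

(** * Inner product of column vectors *)

Section dot_product.
Context (R : realType) (N : nat).
Implicit Types (u v w : 'cV[R]_N) (A : 'M[R]_N).

Definition dot u v : R := \sum_i u i 0 * v i 0.

Lemma dotC u v : dot u v = dot v u.
Proof. by apply: eq_bigr => i _; rewrite mulrC. Qed.

Lemma dotDl u v w : dot (u + v) w = dot u w + dot v w.
Proof. by rewrite -big_split; apply: eq_bigr => i _; rewrite mxE mulrDl. Qed.

Lemma dotDr u v w : dot u (v + w) = dot u v + dot u w.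
Proof. by rewrite dotC dotDl !(dotC u). Qed.

Lemma dotZl a u v : dot (a *: u) v = a * dot u v.
Proof. by rewrite mulr_sumr; apply: eq_bigr => i _; rewrite mxE mulrA. Qed.

Lemma dotZr a u v : dot u (a *: v) = a * dot u v.
Proof. by rewrite dotC dotZl dotC. Qed.

Lemma dotNl u v : dot (- u) v = - dot u v.
Proof. by rewrite -scaleN1r dotZl mulN1r. Qed.

Lemma dotNr u v : dot u (- v) = - dot u v.
Proof. by rewrite dotC dotNl dotC. Qed.

Lemma dot_ge0 u : 0 <= dot u u.
Proof. by apply: sumr_ge0 => i _; rewrite -expr2 sqr_ge0. Qed.

Lemma dot_eq0 u : dot u u = 0 -> u = 0.
Proof.
move=> /eqP; rewrite psumr_eq0 => [/allP h|i _]; last by rewrite -expr2 sqr_ge0.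
apply/colP => i; have := h i; rewrite mem_index_enum mulf_eq0 orbb mxE.
by move=> /(_ isT)/eqP.
Qed.

Lemma dot_mx u v : dot u v = (u^T *m v) 0 0.
Proof. by rewrite mxE; apply: eq_bigr => i _; rewrite mxE. Qed.

Lemma dot_mulmxr A u v : dot u (A *m v) = dot (A^T *m u) v.
Proof. by rewrite !dot_mx trmx_mul trmxK mulmxA. Qed.

Lemma quadE A v : quad A v = dot v (A *m v).
Proof. by rewrite /quad dot_mx mulmxA. Qed.

Lemma cauchy_schwarz u v : dot u v ^+ 2 <= dot u u * dot v v.
Proof.
have [/dot_eq0 ->|u0] := eqVneq (dot u u) 0.
  have z w : dot 0 w = 0 by rewrite -(scale0r (0 : 'cV[R]_N)) dotZl mul0r.
  by rewrite !z expr0n mul0r.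
have upos : 0 < dot u u by rewrite lt_neqAle eq_sym u0 dot_ge0.
(* This square is [dot u u] times the difference of the two sides. *)
have := dot_ge0 (dot u u *: v - dot u v *: u).
rewrite dotDl !dotDr !dotNl !dotNr !dotZl !dotZr (dotC v u) => h.
rewrite -subr_ge0 -(pmulr_rge0 _ upos); apply: le_trans h _.
by rewrite le_eqVlt; apply/orP; left; apply/eqP; ring.
Qed.

Lemma dot_sqrD_le u v : dot (u + v) (u + v) <= 2 * dot u u + 2 * dot v v.
Proof.
have := dot_ge0 (u - v).
by rewrite !dotDl !dotDr !dotNl !dotNr (dotC v u); lra.
Qed.

End dot_product.

(** * Random vectors with essentially bounded coordinates *)

Section random_features.
Context d (T : measurableType d) (R : realType) (P : probability T R) (N : nat).
Implicit Types (u : T -> 'cV[R]_N) (v : 'cV[R]_N) (f : T -> R).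

Definition ess_bounded_cols u := forall i, ess_bounded P (fun x => u x i 0).

(** As a map of [f], the adjoint of [v |-> dot v (u x)], so that an L^2 bound on the latter
    transfers to it. *)
Definition col_expect f u : 'cV[R]_N := \col_i \int[P]_x (f x * u x i 0).

Lemma ess_bounded_dot v u :
  ess_bounded_cols u -> ess_bounded P (fun x => dot v (u x)).
Proof.
move=> bu; apply: ess_bounded_sum => i.
by apply: ess_boundedM => //; exact: ess_bounded_cst.
Qed.

Lemma ess_bounded_dotxx u :
  ess_bounded_cols u -> ess_bounded P (fun x => dot (u x) (u x)).
Proof. by move=> bu; apply: ess_bounded_sum => i; exact: ess_boundedM. Qed.

Lemma ess_bounded_colsD u w : ess_bounded_cols u -> ess_bounded_cols w ->
  ess_bounded_cols (fun x => u x + w x).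
Proof.
by move=> bu bw i; under eq_fun do rewrite mxE; exact: ess_boundedD.
Qed.

Lemma dot_col_expect f u v : ess_bounded P f -> ess_bounded_cols u ->
  dot v (col_expect f u) = \int[P]_x (f x * dot v (u x)).
Proof.
move=> bf bu; have bfu i : ess_bounded P (fun x => f x * u x i 0).
  exact: ess_boundedM.
transitivity (\int[P]_x \sum_i v i 0 * (f x * u x i 0)); last first.
  by apply: eq_Rintegral => x _; rewrite mulr_sumr; apply: eq_bigr => i _; ring.
rewrite expect_sum; last first.
  by move=> i; apply: ess_boundedM => //; exact: ess_bounded_cst.
by apply: eq_bigr => i _; rewrite mxE expectZ.
Qed.

(* Bessel: expand the square of [f - K^-1 * dot (col_expect f u) u]. *)
Lemma col_expect_le f u K : ess_bounded P f -> ess_bounded_cols u -> 0 < K ->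
  (forall v, \int[P]_x (dot v (u x) ^+ 2) <= K * dot v v) ->
  dot (col_expect f u) (col_expect f u) <= K * \int[P]_x (f x ^+ 2).
Proof.
move=> bf bu K0 hK; set p := col_expect f u.
have bd := ess_bounded_dot p bu.
have bfd := ess_boundedM bf bd.
have bf2 := ess_bounded_sqr bf.
have bd2 := ess_bounded_sqr bd.
have bfd' := ess_boundedM (ess_bounded_cst P (- 2 * K^-1)) bfd.
have bd2' := ess_boundedM (ess_bounded_cst P (K^-1 ^+ 2)) bd2.
have /(expect_ge0 P) : forall x, 0 <= (f x - K^-1 * dot p (u x)) ^+ 2.
  by move=> x; rewrite sqr_ge0.
rewrite (_ : (fun x => _) = (fun x => f x ^+ 2 +
  (- 2 * K^-1 * (f x * dot p (u x)) + K^-1 ^+ 2 * dot p (u x) ^+ 2))); last first.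
  by apply/funext => x; ring.
rewrite !expectD//; last exact: ess_boundedD.
rewrite !expectZ// -dot_col_expect// -/p => h.
have := hK p; set I := \int[P]_x _ in h *; set J := \int[P]_x _ in h *.
move=> IK.
have : K^-1 ^+ 2 * J <= K^-1 * dot p p.
  rewrite (_ : K^-1 * dot p p = K^-1 ^+ 2 * (K * dot p p)).
    by rewrite ler_wpM2l// sqr_ge0.
  by field; rewrite gt_eqF.
move=> h2; rewrite mulrC -ler_pdivrMr// mulrC; lra.
Qed.

End random_features.

(** * Bias and kernel moment for perturbed features *)

Section feature_risk.
Context d (T : measurableType d) (R : realType) (P : probability T R) (N : nat).
Variables (psi e : T -> 'cV[R]_N) (f : T -> R) (c : 'cV[R]_N) (G : 'M[R]_N).
(** [kappa], [t], [L] and [eps] all bound squared quantities. Later [kappa] is C1^(-2), [t] is N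
    delta^2, [L] is Cinf^2 N^(2r) and [eps] is a multiple of N^(-2s). *)
Variables (B C2 kappa t L eps : R).
Hypothesis bpsi : ess_bounded_cols P psi.
Hypothesis be : ess_bounded_cols P e.
Hypothesis mf : measurable_fun setT f.
Hypothesis fB : {ae P, forall x, `|f x| <= B}.
Hypothesis C20 : 0 < C2.
Hypothesis psi_le : forall v, \int[P]_x (dot v (psi x) ^+ 2) <= C2 * dot v v.
Hypothesis psi_sup : {ae P, forall x, dot (psi x) (psi x) <= L}.
Hypothesis t0 : 0 < t.
Hypothesis e_sup : {ae P, forall x, dot (e x) (e x) <= t}.
Hypothesis Gsym : G^T = G.
Hypothesis G_le : forall v, dot (G *m v) (G *m v) <= kappa * dot v v.
Hypothesis kappa0 : 0 <= kappa.
Hypothesis f_approx : \int[P]_x ((f x - dot c (psi x)) ^+ 2) <= eps.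

Local Notation phi := (fun x => psi x + e x).
Local Notation g := (fun x => f x - dot c (psi x)).
Local Notation Sc := (col_expect P (fun x => dot c (psi x)) psi).

Let bf : ess_bounded P f. Proof. by split=> //; exists B. Qed.
Let bphi : ess_bounded_cols P phi. Proof. exact: ess_bounded_colsD. Qed.
Let bg : ess_bounded P g.
Proof. exact/ess_boundedB/ess_bounded_dot/bpsi. Qed.

Lemma expect_dot_sup_le (u : T -> 'cV[R]_N) K (v : 'cV[R]_N) :
  ess_bounded_cols P u ->
  {ae P, forall x, dot (u x) (u x) <= K} ->
  \int[P]_x (dot v (u x) ^+ 2) <= K * dot v v.
Proof.
move=> bu hK; apply: le_expect_cst; first exact/ess_bounded_sqr/ess_bounded_dot.
apply: filterS hK => x hK; apply: le_trans (cauchy_schwarz _ _) _.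
by rewrite mulrC ler_wpM2r// dot_ge0.
Qed.

Lemma expect_dot_phi_le (v : 'cV[R]_N) :
  \int[P]_x (dot v (phi x) ^+ 2) <= 2 * (C2 + t) * dot v v.
Proof.
have b1 := ess_bounded_sqr (ess_bounded_dot v bpsi).
have b2 := ess_bounded_sqr (ess_bounded_dot v be).
apply: (@le_trans _ _ (\int[P]_x (2 * (dot v (psi x) ^+ 2 + dot v (e x) ^+ 2)))).
  apply: le_expect; first exact/ess_bounded_sqr/ess_bounded_dot.
    by apply: ess_boundedM; [exact: ess_bounded_cst|exact: ess_boundedD].
  apply: aeW => x; rewrite dotDr.
  by have := sqr_ge0 (dot v (psi x) - dot v (e x)); nra.
rewrite expectZ ?expectD//; last exact: ess_boundedD.
have := psi_le v; have := expect_dot_sup_le v be e_sup; lra.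
Qed.

Lemma expect_sqr_f_le : \int[P]_x (f x ^+ 2) <= B ^+ 2.
Proof.
apply: le_expect_cst; first exact: ess_bounded_sqr.
apply: filterS fB => x fxB.
by rewrite -[leLHS]real_normK ?num_real// lerXn2r ?nnegrE// (le_trans _ fxB).
Qed.

(** The first bound adds [psi_le] over the basis vectors, as for a trace; the second comes from the
    pointwise bound [psi_sup]. *)
Lemma expect_sqr_phi_le :
  \int[P]_x dot (phi x) (phi x) <= 2 * C2 * N%:R + 2 * t
  /\ \int[P]_x dot (phi x) (phi x) <= 2 * L + 2 * t.
Proof.
have b1 := ess_bounded_dotxx bpsi.
have b2 := ess_bounded_dotxx be.
have b3 := ess_boundedM (ess_bounded_cst P 2) b1.
have b4 := ess_boundedM (ess_bounded_cst P 2) b2.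
have H : \int[P]_x dot (phi x) (phi x) <=
    2 * \int[P]_x dot (psi x) (psi x) + 2 * t.
  apply: (@le_trans _ _ (\int[P]_x (2 * dot (psi x) (psi x)
    + 2 * dot (e x) (e x)))).
    apply: le_expect; [exact: ess_bounded_dotxx|exact: ess_boundedD|].
    by apply: aeW => x; exact: dot_sqrD_le.
  rewrite expectD ?expectZ// lerD2l ler_wpM2l//.
  exact: le_expect_cst.
split; apply: le_trans H _; rewrite lerD2r; last first.
  by rewrite ler_wpM2l//; exact: le_expect_cst.
rewrite -mulrA ler_wpM2l// expect_sum; last by move=> i; exact: ess_boundedM.
rewrite -[N in leRHS]card_ord mulr_natr -sumr_const; apply: ler_sum => i _.
have dotd u : dot (delta_mx i 0) u = u i 0.
  rewrite /dot (bigD1 i)//= big1 ?addr0 ?mxE ?eqxx ?mul1r// => j ji.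
  by rewrite mxE (negbTE ji) mul0r.
have := psi_le (delta_mx i 0); rewrite dotd mxE !eqxx mulr1.
by under eq_Rintegral do rewrite dotd expr2.
Qed.

Lemma bias_le :
  \int[P]_x ((f x - dot (G *m col_expect P f phi) (phi x)) ^+ 2)
  <= 4 * (\int[P]_x (dot (c - G *m Sc) (psi x) ^+ 2) + eps
     + 2 * C2 * kappa * (C2 * eps + t * B ^+ 2)
     + 2 * kappa * t * (C2 + t) * B ^+ 2).
Proof.
set m := col_expect P f phi.
pose p1 := col_expect P g psi; pose p2 := col_expect P f e.
have mE : m = Sc + p1 + p2.
  apply/colP => i; rewrite !mxE -expectD; last 2 first.
  - exact/ess_boundedM/bpsi/ess_bounded_dot/bpsi.
  - exact/ess_boundedM/bpsi.
  rewrite -expectD; last 2 first.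
  - apply: ess_boundedD; last exact/ess_boundedM/bpsi.
    exact/ess_boundedM/bpsi/ess_bounded_dot/bpsi.
  - exact/ess_boundedM/be.
  by apply: eq_Rintegral => x _; rewrite mxE; ring.
pose T1 x := dot (c - G *m Sc) (psi x).
pose T3 x := dot (G *m (p1 + p2)) (psi x).
pose T4 x := dot (G *m m) (e x).
have bT1 : ess_bounded P (fun x => T1 x ^+ 2).
  exact/ess_bounded_sqr/ess_bounded_dot/bpsi.
have bg2 : ess_bounded P (fun x => g x ^+ 2) by exact: ess_bounded_sqr.
have bT3 : ess_bounded P (fun x => T3 x ^+ 2).
  exact/ess_bounded_sqr/ess_bounded_dot/bpsi.
have bT4 : ess_bounded P (fun x => T4 x ^+ 2).
  exact/ess_bounded_sqr/ess_bounded_dot/be.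
have b34 := ess_boundedD bT3 bT4.
have b234 := ess_boundedD bg2 b34.
have b1234 := ess_boundedD bT1 b234.
apply: (@le_trans _ _ (\int[P]_x
    (4 * (T1 x ^+ 2 + (g x ^+ 2 + (T3 x ^+ 2 + T4 x ^+ 2)))))).
  apply: le_expect.
  - exact/ess_bounded_sqr/ess_boundedB/ess_bounded_dot/bphi.
  - exact/ess_boundedM/b1234/ess_bounded_cst.
  apply: aeW => x.
  have -> : f x - dot (G *m m) (phi x) = T1 x + g x - T3 x - T4 x.
    rewrite dotDr -/(T4 x) {1}mE -addrA mulmxDr dotDl /T1 /T3 dotDl dotNl; ring.
  move: (T1 x) (g x) (T3 x) (T4 x) => a1 a2 a3 a4.
  (* The six squares add up to four times the sum of the squares minus
     [(a1 + a2 - a3 - a4) ^+ 2]. *)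
  have := sqr_ge0 (a1 - a2); have := sqr_ge0 (a1 + a3).
  have := sqr_ge0 (a1 + a4); have := sqr_ge0 (a2 + a3).
  have := sqr_ge0 (a2 + a4); have := sqr_ge0 (a3 - a4).
  rewrite !expr2; nra.
rewrite expectZ// ler_wpM2l// !expectD// -!addrA lerD2l lerD//.
have fB2 := expect_sqr_f_le.
(* Bessel's inequality, with constant C2 for [psi], [t] for [e] and 2 (C2 + t) for their sum. *)
have p1_le : dot p1 p1 <= C2 * eps.
  by apply: le_trans (col_expect_le bg bpsi C20 psi_le) _; rewrite ler_pM2l.
have p2_le : dot p2 p2 <= t * B ^+ 2.
  apply: le_trans (col_expect_le bf be t0 _) _; last by rewrite ler_pM2l.
  by move=> v; exact: expect_dot_sup_le.
have m_le : dot m m <= 2 * (C2 + t) * B ^+ 2.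
  have K0 : 0 < 2 * (C2 + t) by rewrite mulr_gt0// addr_gt0.
  apply: le_trans (col_expect_le bf bphi K0 _) _; last by rewrite ler_pM2l.
  exact: expect_dot_phi_le.
rewrite lerD//.
  apply: le_trans (psi_le _) _.
  rewrite [leRHS](_ : _ = C2 * (kappa * (2 * (C2 * eps) + 2 * (t * B ^+ 2)))); last ring.
  rewrite ler_pM2l//; apply: le_trans (G_le _) _; rewrite ler_wpM2l//.
  by apply: le_trans (dot_sqrD_le _ _) _; rewrite lerD// ler_pM2l.
apply: le_trans (expect_dot_sup_le _ be e_sup) _.
rewrite [leRHS](_ : _ = t * (kappa * (2 * (C2 + t) * B ^+ 2))); last ring.
by rewrite ler_pM2l//; apply: le_trans (G_le _) _; rewrite ler_wpM2l.
Qed.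

(** Both inner integrals are treated for fixed [x]. The first is linear in [G *m phi x], and the
    symmetry of [G] turns it into [dot (G *m m) (phi x)]; the second is a quadratic form in
    [G *m phi x], at most 2 (C2 + t) kappa |phi x|^2. *)
Lemma feature_risk_le w : 0 <= w ->
  (\int[P]_x ((f x - \int[P]_x' (f x' * dot (phi x') (G *m phi x))) ^+ 2
     + w * \int[P]_x' (dot (phi x') (G *m phi x) ^+ 2))%:E
   <= (4 * (\int[P]_x (dot (c - G *m Sc) (psi x) ^+ 2) + eps
           + 2 * C2 * kappa * (C2 * eps + t * B ^+ 2)
           + 2 * kappa * t * (C2 + t) * B ^+ 2)
       + w * (2 * kappa * (C2 * (2 * C2 * N%:R + 2 * t)
                         + t * (2 * L + 2 * t))))%:E)%E.
Proof.
move=> w0; set m := col_expect P f phi.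
have bb : ess_bounded P (fun x => (f x - dot (G *m m) (phi x)) ^+ 2).
  exact/ess_bounded_sqr/ess_boundedB/ess_bounded_dot/bphi.
have bv := ess_boundedM (ess_bounded_cst P (w * (2 * (C2 + t) * kappa)))
  (ess_bounded_dotxx bphi).
apply: (@le_trans _ _ (\int[P]_x ((f x - dot (G *m m) (phi x)) ^+ 2
    + w * (2 * (C2 + t) * kappa) * dot (phi x) (phi x))%:E)%E).
  apply: le_integral_nonmeasurable => x.
    by rewrite lee_fin addr_ge0 ?sqr_ge0// mulr_ge0// expect_ge0// => x';
      rewrite sqr_ge0.
  rewrite lee_fin lerD//.
    under eq_Rintegral do rewrite dotC.
    rewrite -(dot_col_expect _ bf bphi).
    by rewrite -/m dotC dot_mulmxr Gsym.
  rewrite -mulrA ler_wpM2l//; under eq_Rintegral do rewrite dotC.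
  apply: le_trans (expect_dot_phi_le _) _.
  rewrite -[leRHS]mulrA ler_pM2l ?G_le//.
  by rewrite mulr_gt0// addr_gt0.
rewrite EFin_Rintegral; last exact: ess_boundedD.
rewrite lee_fin expectD// lerD ?bias_le// expectZ; last exact: ess_bounded_dotxx.
rewrite -[leLHS]mulrA ler_wpM2l//.
(* The summand with C2 takes the trace bound, the one with [t] the pointwise bound; so [L] occurs
   only multiplied by [t]. *)
have [h1 h2] := expect_sqr_phi_le.
rewrite [leLHS](_ : _ = 2 * kappa * (C2 * \int[P]_x dot (phi x) (phi x)
   + t * \int[P]_x dot (phi x) (phi x))); last ring.
by rewrite ler_wpM2l ?mulr_ge0// lerD// ler_pM2l.
Qed.

End feature_risk.

(** * Positive definite matrices and the ridge inverse *)

Section ridge_inverse.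
Context (R : realType) (N : nat).
Implicit Types (A S K G M : 'M[R]_N) (u v : 'cV[R]_N).

Lemma psdmx_sym A : psdmx A -> A^T = A. Proof. by case. Qed.

Lemma mulmx_inj_unit A : (forall v, A *m v = 0 -> v = 0) -> A \in unitmx.
Proof.
move=> h; rewrite -unitmx_tr -row_free_unit; apply: inj_row_free => v vA.
apply: trmx_inj; rewrite trmx0; apply: h; apply: trmx_inj.
by rewrite trmx_mul trmxK vA trmx0.
Qed.

Lemma pdmx_unit A : pdmx A -> A \in unitmx.
Proof.
move=> [_ pA]; apply: mulmx_inj_unit => v Av0; apply/eqP; apply: contraT => v0.
by have := pA v v0; rewrite quadE Av0 -(scale0r v) dotZr mul0r ltxx.
Qed.

Lemma pdmx_psd A : pdmx A -> psdmx A.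
Proof.
move=> [sA pA]; split=> // v; have [->|/pA/ltW//] := eqVneq v 0.
by rewrite quadE mulmx0 -(scale0r (0 : 'cV[R]_N)) dotZr mul0r.
Qed.

Lemma psdmx_conj S M : psdmx S -> psdmx (M^T *m S *m M).
Proof.
move=> [sS pS]; split; first by rewrite !trmx_mul trmxK sS mulmxA.
by move=> v; have := pS (M *m v); rewrite /quad !trmx_mul !mulmxA.
Qed.

(* If [A] is not a unit then [invmx A] is [A] itself. *)
Lemma psdmx_inv A : psdmx A -> psdmx (invmx A).
Proof.
move=> pA; have [uA|nA] := boolP (A \in unitmx); last first.
  by rewrite /invmx (negbTE nA).
have [sA _] := pA; have := psdmx_conj (invmx A) pA.
by rewrite trmx_inv sA mulVmx// mul1mx.
Qed.

Section coercive.
Variables (C1 : R) (A : 'M[R]_N).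
Hypothesis C1_gt0 : 0 < C1.
Hypothesis Asym : A^T = A.
Hypothesis A_ge : forall v, C1 * dot v v <= quad A v.

Lemma coercive_unit : A \in unitmx.
Proof.
apply: mulmx_inj_unit => v Av0; apply: dot_eq0; apply/eqP.
rewrite eq_le dot_ge0 andbT -(pmulr_rle0 _ C1_gt0).
apply: le_trans (A_ge v) _.
by rewrite quadE Av0 -(scale0r v) dotZr mul0r.
Qed.

Lemma coercive_inv_sym : (invmx A)^T = invmx A.
Proof. by rewrite trmx_inv Asym. Qed.

Let inv_ge v : C1 * dot (invmx A *m v) (invmx A *m v) <= dot v (invmx A *m v).
Proof.
apply: le_trans (A_ge _) _.
by rewrite quadE mulmxA mulmxV ?mul1mx ?coercive_unit// dotC.
Qed.

(** The square is |v - C1 A^-1 v|^2. Combined with [inv_ge], which is coercivity at [invmx A *m v],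
    it yields both |A^-1 v| <= |v| / C1 and A^-1 <= 1 / C1 without diagonalizing [A]. *)
Let sqr_expand v : 0 <= dot v v - 2 * C1 * dot v (invmx A *m v)
  + C1 ^+ 2 * dot (invmx A *m v) (invmx A *m v).
Proof.
have := dot_ge0 (v - C1 *: (invmx A *m v)).
rewrite dotDl !dotDr !dotNl !dotNr !dotZl !dotZr (dotC _ v) => h.
by apply: le_trans h _; rewrite le_eqVlt; apply/orP; left; apply/eqP; ring.
Qed.

Lemma coercive_inv_norm v :
  dot (invmx A *m v) (invmx A *m v) <= C1 ^- 2 * dot v v.
Proof.
rewrite -(ler_pM2l (exprn_gt0 2 C1_gt0)) mulrA divff ?mul1r; last first.
  by rewrite gt_eqF// exprn_gt0.
have := sqr_expand v; have := inv_ge v.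
rewrite -(ler_pM2l C1_gt0 (C1 * _)); lra.
Qed.

Lemma coercive_inv_loewner C3 : C1^-1 <= C3 ->
  loewner_le 0 (invmx A) /\ loewner_le (invmx A) C3%:M.
Proof.
move=> C13; split; split.
- by rewrite subr0 coercive_inv_sym.
- move=> v; rewrite subr0 quadE; apply: le_trans (inv_ge v).
  by rewrite mulr_ge0 ?dot_ge0// ltW.
- by rewrite linearB/= tr_scalar_mx coercive_inv_sym.
- move=> v; rewrite quadE mulmxBl dotDr dotNr mul_scalar_mx dotZr subr_ge0.
  apply: (@le_trans _ _ (C1^-1 * dot v v)); last by rewrite ler_wpM2r// dot_ge0.
  rewrite -(ler_pM2l C1_gt0) mulrA divff ?mul1r ?gt_eqF//.
  have := sqr_expand v; have := inv_ge v.
  rewrite -(ler_pM2l C1_gt0 (C1 * _)); lra.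
Qed.

End coercive.

(* With [A = S + K/n] and [G = A^-1] one has [1 - G S = G K / n], so that the
   trace equals [(tr (G S) - tr (G S G S)) / n], where [tr (G S) <= tr 1]. *)
Lemma ridge_trace_le S Sb A (n : nat) :
  (0 < n)%N -> psdmx S -> pdmx Sb ->
  (forall M, psdmx M -> 0 <= \tr (M *m S)) ->
  (forall M, psdmx M -> 0 <= \tr (M *m Sb)) ->
  A = S + n%:R^-1 *: invmx Sb -> A \in unitmx ->
  \tr ((1%:M - invmx A *m S)^T *m S *m (1%:M - invmx A *m S) *m Sb)
    <= N%:R / n%:R.
Proof.
move=> n0 pS pSb trS trSb AE uA.
have n0R : (n%:R : R) != 0 by rewrite pnatr_eq0 -lt0n.
have n_gt0 : (0 : R) < n%:R by rewrite ltr0n.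
have uSb := pdmx_unit pSb.
have pSb' := pdmx_psd pSb.
set K := invmx Sb in AE; set G := invmx A; set D := 1%:M - G *m S.
have pK : psdmx K by exact: psdmx_inv.
have sK := psdmx_sym pK; have sS := psdmx_sym pS.
have sA : A^T = A by rewrite AE linearD/= linearZ/= sK sS.
have sG : G^T = G by rewrite trmx_inv sA.
have pA : psdmx A.
  split=> // v; rewrite quadE AE mulmxDl dotDr -scalemxAl dotZr -!quadE.
  by rewrite addr_ge0 ?mulr_ge0 ?invr_ge0 ?(ltW n_gt0)//; [case: pS|case: pK].
have pG : psdmx G by exact: psdmx_inv.
have KE : K = n%:R *: (A - S).
  by rewrite AE addrC addKr scalerA divff// scale1r.
have DE : D = n%:R^-1 *: (G *m K).
  by rewrite KE -scalemxAr scalerA mulVf// scale1r mulmxBr mulVmx.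
have KSb : K *m Sb = 1%:M by rewrite mulVmx.
have SbK : Sb *m K = 1%:M by rewrite mulmxV.
have trGS : \tr (G *m S) <= N%:R.
  have -> : S = A - n%:R^-1 *: K by rewrite AE addrK.
  rewrite mulmxBr mulVmx// -scalemxAr linearB/= linearZ/= mxtrace1 gerBl.
  rewrite mulr_ge0 ?invr_ge0 ?(ltW n_gt0)//.
  (* Positivity is given for traces against [Sb]; since Sb K = 1, the trace of K G K Sb is that of G
     K. *)
  have := trSb _ (psdmx_conj K pG).
  by rewrite sK mxtrace_mulC !mulmxA SbK mul1mx.
have trGSGS : 0 <= \tr (G *m S *m G *m S).
  by have := trS _ (psdmx_conj G pS); rewrite sG.
have -> : \tr (D^T *m S *m D *m Sb) =
    n%:R^-1 * (\tr (G *m S) - \tr (G *m S *m G *m S)).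
  have DT : D^T = n%:R^-1 *: (K *m G) by rewrite DE linearZ/= trmx_mul sK sG.
  (* K Sb = 1 cancels one [K]; the other is then written as n (A - S), which leaves a single factor
     1/n. *)
  have -> : D^T *m S *m D *m Sb = n%:R^-1 ^+ 2 *: (K *m (G *m S *m G)).
    rewrite DT DE -!scalemxAl -!scalemxAr -!scalemxAl scalerA.
    by rewrite -!mulmxA KSb mulmx1.
  rewrite linearZ/= mxtrace_mulC {1}KE -scalemxAr linearZ/= mulmxBr linearB/=.
  rewrite -(mulmxA _ G A) mulVmx// mulmx1.
  by field.
rewrite mulrC ler_wpM2r ?invr_ge0 ?(ltW n_gt0)//; lra.
Qed.

End ridge_inverse.

(** * Second moment matrices of square integrable vectors *)

Section gram.
Context d (T : measurableType d) (R : realType) (P : probability T R) (N : nat).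
Variable u : T -> 'cV[R]_N.
Hypothesis u2 : forall i, (fun x => u x i 0) \in Lfun P 2%:E.

Definition gram : 'M[R]_N := \matrix_(i, j) \int[P]_x (u x i 0 * u x j 0).

Let integrable_uu i j :
  P.-integrable setT (EFin \o (fun x => u x i 0 * u x j 0)).
Proof. exact/Lfun1_integrable/Lfun2_mul_Lfun1. Qed.

(** Expand the quadratic form and integrate entrywise. The coordinates are only assumed square
    integrable, since coefficients drawn from [Pbeta] may be unbounded. *)
Lemma integral_quad_gram (M : 'M[R]_N) :
  (\int[P]_x (quad M (u x))%:E)%E = (\tr (M *m gram))%:E.
Proof.
transitivity (\int[P]_x (\sum_i \sum_j
    (M i j)%:E * (u x i 0 * u x j 0)%:E))%E.
  apply: eq_integral => x _; rewrite quadE /dot -sumEFin.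
  apply: eq_bigr => i _; rewrite mxE mulr_sumr -sumEFin.
  by apply: eq_bigr => j _; rewrite -EFinM; congr EFin; ring.
have iM i j : P.-integrable setT
    (fun x => (M i j)%:E * (u x i 0 * u x j 0)%:E)%E.
  by apply: integrableZl => //; exact: integrable_uu.
rewrite integral_sum//; last by move=> i; exact: integrable_sum.
rewrite /mxtrace -sumEFin; apply: eq_bigr => i _.
rewrite integral_sum// mxE -sumEFin; apply: eq_bigr => j _.
rewrite integralZl//=; last exact: integrable_uu.
rewrite EFinM; congr (_ * _)%E.
rewrite mxE fineK; last exact/integrable_fin_num/integrable_uu.
by apply: eq_integral => x _; rewrite mulrC.
Qed.

Lemma measurable_quad (M : 'M[R]_N) :
  measurable_fun setT (fun x => quad M (u x)).
Proof.
under eq_fun do rewrite quadE /dot.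
have mu i : measurable_fun setT (fun x => u x i 0).
  by have := sub_Lfun_mfun (u2 i); rewrite inE.
apply: measurable_sum => i; apply: measurable_funM => //.
under eq_fun do rewrite mxE.
by apply: measurable_sum => j; exact: measurable_funM.
Qed.

(** The trace is the mean of a nonnegative quadratic form; this supplies the positivity asked by
    [ridge_trace_le] without a matrix square root. *)
Lemma gram_trace_ge0 (M : 'M[R]_N) : psdmx M -> 0 <= \tr (M *m gram).
Proof.
move=> [_ pM]; rewrite -lee_fin -integral_quad_gram.
by apply: integral_ge0 => x _; rewrite lee_fin.
Qed.

Lemma integral_dot_gram (v : 'cV[R]_N) :
  (\int[P]_x (dot v (u x) ^+ 2)%:E)%E = (quad gram v)%:E.
Proof.
(* The square is the quadratic form of the rank-one matrix v v^T. *)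
rewrite (_ : quad gram v = \tr ((v *m v^T) *m gram)); last first.
  by rewrite -mulmxA mxtrace_mulC /quad {1}/mxtrace big_ord1.
rewrite -integral_quad_gram; apply: eq_integral => x _; congr EFin.
rewrite quadE -mulmxA !dot_mx mulmxA [RHS]mxE big_ord1 expr2; congr (_ * _).
by rewrite -!dot_mx dotC.
Qed.

Lemma gram_sym : gram^T = gram.
Proof.
by apply/matrixP => i j; rewrite !mxE; apply: eq_Rintegral => x _; rewrite mulrC.
Qed.

End gram.

(** * Lebesgue norms as almost sure bounds and as integrals *)

Section Lnorm_bounds.
Context d (T : measurableType d) (R : realType) (P : probability T R).

Lemma Lnorm_oo_ae (f : T -> \bar R) K :
  ('N[P]_+oo[f] <= K)%E -> {ae P, forall x, (`|f x| <= K)%E}.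
Proof.
rewrite unlock /= probability_setT lte01 => fK.
by apply: filterS (ess_sup_ge P (abse \o f)) => x /le_trans; exact.
Qed.

Lemma Lnorm2_sqr (f : T -> R) :
  ('N[P]_2%:E[EFin \o f] ^+ 2 = \int[P]_x (f x ^+ 2)%:E)%E.
Proof.
have -> : (\int[P]_x (f x ^+ 2)%:E = 'N[P]_2%:E[EFin \o f] `^ 2)%E.
  rewrite poweR_Lnorm//; apply: eq_integral => x _ /=.
  by rewrite powR_mulrn// real_normK ?num_real.
case: ('N[P]_2%:E[EFin \o f])%E (Lnorm_ge0 P 2%:E (EFin \o f)) => [x x0||//].
  by rewrite poweR_EFin powR_mulrn// EFin_expe.
by move=> _; rewrite expe2 mulyy poweRyr// pnatr_eq0.
Qed.

End Lnorm_bounds.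

Lemma Lfun2_sum d (T : measurableType d) (R : realType) (P : probability T R)
    I (s : seq I) (a : I -> R) (h : I -> T -> R) :
  (forall i, h i \in Lfun P 2%:E) ->
  (fun x => \sum_(i <- s) a i * h i x) \in Lfun P 2%:E.
Proof.
move=> h2; have [z lin] := Lfun_submod_closed P (lee1n 2).
elim: s => [|i s IHs]; first by under eq_fun do rewrite big_nil.
by under eq_fun do rewrite big_cons; exact: lin (h2 i) IHs.
Qed.

(** * The coefficients on the window *)

Section window_coefficients.
Context (R : realType) (d : nat) (X : set (d.-tuple R)) (X0 : X !=set0).
Context (PX : probability (domain X0) R) (Pbeta : probability (Rinfty R) R).
Variables (psi : nat -> domain X0 -> R) (lo hi N : nat).
Hypothesis lo_gt0 : (1 <= lo)%N.
Hypothesis lo_hi : (lo < hi)%N.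
Hypothesis hiN : (hi - lo + 1 = N)%N.
Hypothesis independent : forall c : 'cV[R]_N,
  {ae PX, forall x, window_sum psi lo c x = 0} -> c = 0.
Hypothesis span : forall j, (j < lo.-1)%N ->
  exists c : 'cV[R]_N, {ae PX, forall x, psi j x = window_sum psi lo c x}.
Hypothesis b2 : forall j, (fun b : Rinfty R => b j) \in Lfun Pbeta 2%:E.
Hypothesis beta_pd : pdmx (Sigma_beta Pbeta hi).

Definition prefix_col (b : Rinfty R) : 'cV[R]_hi := \col_(j < hi) b j.

Lemma window_sumB (c c' : 'cV[R]_N) (x : domain X0) :
  window_sum psi lo (c - c') x = window_sum psi lo c x - window_sum psi lo c' x.
Proof.
rewrite /window_sum -sumrB; apply: eq_bigr => i _.
by rewrite [(c - c') i 0]mxE [(- c') i 0]mxE mulrBl.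
Qed.

(** The columns of [M] before the window hold the coefficients given by [span]; the others form an
    identity block, with offset [lo.-1] since [lo] counts from one. This block makes [M^T]
    injective, and linear independence identifies the vector picked by [xget]. *)
Lemma window_coefE : exists2 M : 'M[R]_(N, hi),
  (forall v : 'cV[R]_N, M^T *m v = 0 -> v = 0) &
  (forall b, {ae PX, forall x, partial_sum psi hi b x =
     window_sum psi lo (M *m prefix_col b) x} /\
   window_coef PX psi lo hi N b = M *m prefix_col b).
Proof.
have /choice[t tP] : forall j, exists c : 'cV[R]_N, (j < lo.-1)%N ->
    {ae PX, forall x, psi j x = window_sum psi lo c x}.
  by move=> j; case: (ltnP j lo.-1) => [/span[c]|]; [exists c|exists 0].
pose M : 'M[R]_(N, hi) := \matrix_(i, j)
  (if (j < lo.-1)%N then t j i 0 else (j == lo.-1 + i :> nat)%N%:R).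
have idx (i : 'I_N) : (lo.-1 + i < hi)%N by case: i => i /=; lia.
have psiM : {ae PX, forall x, forall j : 'I_hi,
    psi j x = \sum_i M i j * window psi lo i x}.
  have : {ae PX, forall x, forall j, (j < lo.-1)%N ->
      psi j x = window_sum psi lo (t j) x}.
    apply: ae_foralln => j; have [/tP h|lej] := ltnP j lo.-1.
      by apply: filterS h.
    exact: aeW.
  apply: filterS => x tx j; have [jlo|lej] := ltnP j lo.-1.
    by rewrite tx//; apply: eq_bigr => i _; rewrite mxE jlo.
  have jN : (j - lo.-1 < N)%N by have := ltn_ord j; lia.
  rewrite (bigD1 (Ordinal jN))//= big1 ?addr0; last first.
    move=> i /eqP ij; rewrite mxE ltnNge lej/=.
    case: eqP => [e|]; last by rewrite mul0r.
    by exfalso; apply: ij; apply: val_inj => /=; lia.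
  by rewrite mxE ltnNge lej/= subnKC// eqxx mul1r /window/= subnKC.
have partialM b : {ae PX, forall x, partial_sum psi hi b x =
     window_sum psi lo (M *m prefix_col b) x}.
  apply: filterS psiM => x psiM.
  rewrite /partial_sum; under eq_bigr do rewrite psiM mulr_sumr.
  rewrite exchange_big; apply: eq_bigr => i _.
  rewrite [_ i 0]mxE mulr_suml; apply: eq_bigr => j _.
  by rewrite [prefix_col b j 0]mxE; ring.
exists M => [v Mv0|b].
  apply/colP => i; have := congr1 (fun u : 'cV[R]_hi => u (Ordinal (idx i)) 0) Mv0.
  rewrite !mxE => <-; rewrite (bigD1 i)//= big1 ?addr0 => [|i' i'i].
    by rewrite !mxE/= ltnNge leq_addr/= eqxx mul1r.
  by rewrite !mxE/= ltnNge leq_addr/= eqn_add2l eq_sym (inj_eq val_inj)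
    (negbTE i'i) mul0r.
split=> //; rewrite /window_coef.
have h := xgetPex 0 (ex_intro (fun c => {ae PX, forall x,
  partial_sum psi hi b x = window_sum psi lo c x}) _ (partialM b)).
apply/eqP; rewrite -subr_eq0; apply/eqP/independent.
apply: filterS2 h (partialM b) => x h1 h2.
rewrite window_sumB; apply/eqP; rewrite subr_eq0; apply/eqP.
by rewrite -h2; exact/esym/h1.
Qed.

Lemma window_coef_Lfun2 i :
  (fun b => window_coef PX psi lo hi N b i 0) \in Lfun Pbeta 2%:E.
Proof.
have [M _ Mb] := window_coefE.
rewrite (_ : (fun _ => _) = (fun b : Rinfty R => \sum_(j < hi) M i j * b j)).
  exact: Lfun2_sum.
apply/funext => b; rewrite (Mb b).2 mxE.
by apply: eq_bigr => j _; rewrite mxE.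
Qed.

Lemma Sigma_bar_gram :
  Sigma_bar PX Pbeta psi lo hi N = gram Pbeta (window_coef PX psi lo hi N).
Proof. by []. Qed.

(** As bar beta = M beta, the matrix is M Sigma_beta M^T, and [M^T] is injective. *)
Lemma Sigma_bar_pd : pdmx (Sigma_bar PX Pbeta psi lo hi N).
Proof.
have [M M_inj Mb] := window_coefE.
split=> [|v v0]; first by rewrite Sigma_bar_gram gram_sym.
have pb2 (j : 'I_hi) : (fun b => prefix_col b j 0) \in Lfun Pbeta 2%:E.
  by under eq_fun do rewrite mxE; exact: b2.
have -> : quad (Sigma_bar PX Pbeta psi lo hi N) v =
    quad (Sigma_beta Pbeta hi) (M^T *m v).
  apply: EFin_inj; rewrite Sigma_bar_gram -integral_dot_gram; last first.
    exact: window_coef_Lfun2.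
  rewrite (_ : Sigma_beta Pbeta hi = gram Pbeta prefix_col); last first.
    by apply/matrixP => i j; rewrite !mxE; apply: eq_Rintegral => b _; rewrite !mxE.
  rewrite -integral_dot_gram//; apply: eq_integral => b _.
  by rewrite (Mb b).2 !dot_mx trmx_mul trmxK mulmxA.
by apply: beta_pd.2; apply: contra_neq v0; exact: M_inj.
Qed.

End window_coefficients.

(** Clipping is the nearest-point projection onto [-B, B], an interval that contains [f]. *)
Lemma clip_contract (R : realType) (B f u : R) :
  `|f| <= B -> (f - clip B u) ^+ 2 <= (f - u) ^+ 2.
Proof.
rewrite ler_norml => /andP[Bf fB]; rewrite /clip.
have [uB|Bu] := leP u B; have [h|h] := leP _ (- B) => //; nra.
Qed.

(** Removes the square root from [A1_sup]; an infinite [y] is excluded because its root would be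
    infinite. *)
Lemma poweR_half_le (R : realType) (y : \bar R) (K : R) :
  (0 <= y)%E -> (y `^ 2^-1 <= K%:E)%E -> (y <= (K ^+ 2)%:E)%E.
Proof.
case: y => [y|_|//]; last by rewrite poweRyr ?invr_eq0//= leye_eq.
rewrite poweR_EFin !lee_fin => y0 yK.
rewrite -[leLHS]powRr1// -[in leLHS](mulVf (_ : 2%:R != 0 :> R)) ?pnatr_eq0//.
rewrite powRrM powR_mulrn ?powR_ge0// lerXn2r ?nnegrE ?powR_ge0//.
exact: le_trans (powR_ge0 _ _) yK.
Qed.

(** * The risk conditional on the coefficients *)

Section fixed_window.
Context (R : realType) (d : nat) (X : set (d.-tuple R)) (X0 : X !=set0).
Context (PX : probability (domain X0) R) (Pxi : probability R R).
Variables (psi : nat -> domain X0 -> R) (lo N : nat).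
Variables (f : domain X0 -> R) (phi : domain X0 -> 'cV[R]_N) (c : 'cV[R]_N).
Variables (G : 'M[R]_N) (B B' C2 kappa L delta eps sigma : R).
(** Will be the partial sum of length [hi N], which equals the window sum only almost everywhere. *)
Variable h : domain X0 -> R.
Hypothesis psi2 : forall j, psi j \in Lfun PX 2%:E.
Hypothesis C20 : 0 < C2.
Hypothesis Sigma_le : loewner_le (Sigma_Psi PX psi lo N) C2%:M.
Hypothesis psi_sup :
  {ae PX, forall x, \sum_(i < N) window psi lo i x ^+ 2 <= L}.
Hypothesis N_gt0 : (0 < N)%N.
Hypothesis mphi : forall i, measurable_fun setT (fun x => phi x i 0).
Hypothesis phi_le : forall x, norm2 (phi x) <= B'.
Hypothesis delta0 : 0 < delta.
Hypothesis phi_approx : forall i : 'I_N,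
  ('N[PX]_(+oo)[(fun x => (window psi lo i x - phi x i 0)%:E)] <= delta%:E)%E.
Hypothesis mf : measurable_fun setT f.
Hypothesis fB : {ae PX, forall x, `|f x| <= B}.
Hypothesis mh : measurable_fun setT h.
Hypothesis h_window : {ae PX, forall x, h x = window_sum psi lo c x}.
Hypothesis fh : (\int[PX]_x ((f x - h x) ^+ 2)%:E <= eps%:E)%E.
Hypothesis mean0 : \int[Pxi]_e e = 0.
Hypothesis xi_le : {ae Pxi, forall e, `|e| <= sigma}.
Hypothesis Gsym : G^T = G.
Hypothesis G_le : forall v, dot (G *m v) (G *m v) <= kappa * dot v v.
Hypothesis kappa0 : 0 <= kappa.

Local Notation S := (Sigma_Psi PX psi lo N).

Definition psi_col (x : domain X0) : 'cV[R]_N := \col_i window psi lo i x.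

Lemma Sigma_Psi_gram : S = gram PX psi_col.
Proof.
by apply/matrixP => i j; rewrite !mxE; apply: eq_Rintegral => x _; rewrite !mxE.
Qed.

Lemma psi_col_Lfun2 i : (fun x => psi_col x i 0) \in Lfun PX 2%:E.
Proof. by under eq_fun do rewrite mxE; exact: psi2. Qed.

Lemma psi_col_dotxx x : dot (psi_col x) (psi_col x) =
  \sum_(i < N) window psi lo i x ^+ 2.
Proof. by apply: eq_bigr => i _; rewrite mxE expr2. Qed.

Lemma psi_col_bounded : ess_bounded_cols PX psi_col.
Proof.
move=> i; split; first by have := sub_Lfun_mfun (psi_col_Lfun2 i); rewrite inE.
(* Avoids a square root: |a| <= a^2 + 1 for every real a. *)
exists (L + 1); apply: filterS psi_sup => x hx.
have : psi_col x i 0 ^+ 2 <= L.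
  apply: le_trans hx; rewrite (bigD1 i)//= mxE lerDl sumr_ge0// => j _.
  exact: sqr_ge0.
rewrite -[X in X <= _]real_normK ?num_real//.
by have := sqr_ge0 (`|psi_col x i 0| - 1); nra.
Qed.

Let e x := phi x - psi_col x.

Let be : ess_bounded_cols PX e.
Proof.
move=> i; under eq_fun do rewrite mxE [X in _ + X]mxE.
apply: ess_boundedB (psi_col_bounded i); split=> //.
exists B'; apply: aeW => x; apply: le_trans (phi_le x).
rewrite -[leLHS]sqrtr_sqr; apply: ler_wsqrtr.
by rewrite (bigD1 i)//= lerDl sumr_ge0// => j _; rewrite sqr_ge0.
Qed.

Let e_sup : {ae PX, forall x, dot (e x) (e x) <= N%:R * delta ^+ 2}.
Proof.
have : {ae PX, forall x, forall i : 'I_N, e x i 0 ^+ 2 <= delta ^+ 2}.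
  (* [ae_foralln] ranges over [nat], so the index is passed as a number with a proof of its
     bound. *)
  have : {ae PX, forall x, forall k, forall kN : (k < N)%N,
      e x (Ordinal kN) 0 ^+ 2 <= delta ^+ 2}.
    apply: ae_foralln => k; have [kN|Nk] := pselect (k < N)%N; last first.
      by apply: aeW => x kN; have := Nk kN.
    apply: filterS (Lnorm_oo_ae (phi_approx (Ordinal kN))) => x hx kN'.
    rewrite (bool_irrelevance kN' kN); move: hx; rewrite lee_fin distrC => hx.
    rewrite -[leLHS]real_normK ?num_real// lerXn2r ?nnegrE ?(ltW delta0)//.
    by rewrite !mxE.
  by apply: filterS => x hx [k kN].
apply: filterS => x hx; rewrite -[N in leRHS]card_ord mulrC mulr_natr -sumr_const.
by apply: ler_sum => i _; rewrite -expr2.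
Qed.

Let expect_dot_psi v : \int[PX]_x (dot v (psi_col x) ^+ 2) = quad S v.
Proof.
rewrite Sigma_Psi_gram; apply: EFin_inj; rewrite -integral_dot_gram.
  rewrite EFin_Rintegral//.
  exact/ess_bounded_sqr/ess_bounded_dot/psi_col_bounded.
exact: psi_col_Lfun2.
Qed.

Let psi_le v : \int[PX]_x (dot v (psi_col x) ^+ 2) <= C2 * dot v v.
Proof.
rewrite expect_dot_psi; have := Sigma_le.2 v.
by rewrite !quadE mulmxBl dotDr dotNr mul_scalar_mx dotZr subr_ge0.
Qed.

Let window_sumE x : window_sum psi lo c x = dot c (psi_col x).
Proof. by apply: eq_bigr => i _; rewrite mxE. Qed.

Let f_approx : \int[PX]_x ((f x - dot c (psi_col x)) ^+ 2) <= eps.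
Proof.
have bg : ess_bounded PX (fun x => (f x - dot c (psi_col x)) ^+ 2).
  apply/ess_bounded_sqr/ess_boundedB/ess_bounded_dot/psi_col_bounded.
  by split=> //; exists B.
rewrite -lee_fin -EFin_Rintegral//; apply: le_trans fh.
rewrite le_eqVlt; apply/orP; left; apply/eqP; apply: ge0_ae_eq_integral => //.
- by apply/measurable_EFinP; case: bg.
- by apply/measurable_EFinP/measurable_funX/measurable_funB.
- by move=> x _; rewrite lee_fin sqr_ge0.
- by move=> x _; rewrite lee_fin sqr_ge0.
- by apply: filterS h_window => x + _; rewrite window_sumE => ->.
Qed.

Let col_expect_psi : col_expect PX (fun x => dot c (psi_col x)) psi_col = S *m c.
Proof.
have bp := psi_col_bounded.
rewrite Sigma_Psi_gram; apply/colP => i; rewrite !mxE.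
under eq_Rintegral do rewrite mulr_suml.
rewrite expect_sum; last first.
  move=> j; apply/ess_boundedM/bp/ess_boundedM/bp; exact: ess_bounded_cst.
apply: eq_bigr => j _; rewrite mxE mulrC -expectZ; last exact: ess_boundedM.
by apply: eq_Rintegral => x _; ring.
Qed.

Let predictor_dot x' x :
  ((phi x')^T *m G^T *m phi x) 0 0 = dot (phi x') (G *m phi x).
Proof. by rewrite Gsym dot_mx mulmxA. Qed.

Let predictor_bounded : exists H, forall x' x, `|dot (phi x') (G *m phi x)| <= H.
Proof.
have phi2 x : dot (phi x) (phi x) <= B' ^+ 2.
  have -> : dot (phi x) (phi x) = norm2 (phi x) ^+ 2.
    rewrite sqr_sqrtr; last by rewrite sumr_ge0// => i _; rewrite sqr_ge0.
    by apply: eq_bigr => i _; rewrite expr2.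
  by rewrite lerXn2r ?nnegrE ?sqrtr_ge0// (le_trans _ (phi_le x))// sqrtr_ge0.
exists (B' ^+ 2 * (kappa * B' ^+ 2) + 1) => x' x.
have hcs : `|dot (phi x') (G *m phi x)| ^+ 2 <= B' ^+ 2 * (kappa * B' ^+ 2).
  rewrite real_normK ?num_real//; apply: le_trans (cauchy_schwarz _ _) _.
  rewrite ler_pM ?dot_ge0//; apply: le_trans (G_le _) _.
  by rewrite ler_wpM2l.
have := sqr_ge0 (`|dot (phi x') (G *m phi x)| - 1); nra.
Qed.

Let measurable_predictor :
  measurable_fun setT (fun z => dot (phi z.1) (G *m phi z.2)).
Proof.
apply: measurable_sum => i; apply: measurable_funM.
  exact: (measurableT_comp (mphi i) measurable_fst).
under eq_fun do rewrite mxE.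
apply: measurable_sum => j; apply: measurable_funM => //.
exact: (measurableT_comp (mphi j) measurable_snd).
Qed.

Local Notation D := (1%:M - G *m S).
Local Notation t := (N%:R * delta ^+ 2).

(** Chains [prompt_risk_le] and [feature_risk_le], the latter with error [phi - psi_col]. The second
    moment of the shrinkage bias becomes [quad (D^T *m S *m D) c], the form in [c] that will be
    averaged over beta. *)
Lemma conditional_risk_le (n : nat) : (0 < n)%N ->
  (\int[iid_law PX n]_xs \int[iid_law Pxi n]_xi \int[PX]_x
    ((f x - predictor B (G, phi) xs
      [tuple f (tnth xs k) + tnth xi k | k < n] x) ^+ 2)%:E
   <= (4 * (quad (D^T *m S *m D) c + eps
           + 2 * C2 * kappa * (C2 * eps + t * B ^+ 2)
           + 2 * kappa * t * (C2 + t) * B ^+ 2)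
       + (B ^+ 2 + sigma ^+ 2) / n%:R
         * (2 * kappa * (C2 * (2 * C2 * N%:R + 2 * t)
                         + t * (2 * L + 2 * t))))%:E)%E.
Proof.
move=> n0.
have [H hH] := predictor_bounded.
have w0 : 0 <= (B ^+ 2 + sigma ^+ 2) / n%:R.
  by rewrite divr_ge0 ?addr_ge0 ?sqr_ge0.
have t0 : 0 < t by rewrite mulr_gt0 ?ltr0n ?exprn_gt0.
have psi_sup' : {ae PX, forall x, dot (psi_col x) (psi_col x) <= L}.
  by apply: filterS psi_sup => x; rewrite psi_col_dotxx.
have := feature_risk_le psi_col_bounded be mf fB C20 psi_le psi_sup' t0 e_sup
  Gsym G_le kappa0 f_approx w0.
rewrite expect_dot_psi col_expect_psi.
rewrite (_ : quad S (c - G *m (S *m c)) = quad (D^T *m S *m D) c); last first.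
  have -> : c - G *m (S *m c) = D *m c by rewrite mulmxBl mul1mx mulmxA.
  by rewrite /quad trmx_mul !mulmxA.
apply: le_trans.
have prompt := prompt_risk_le n0 mf fB measurable_predictor hH mean0 xi_le.
refine (le_trans (le_trans _ prompt) _); last first.
  rewrite le_eqVlt; apply/orP; left; apply/eqP; apply: eq_integral => x _.
  have phiE x' : psi_col x' + e x' = phi x' by rewrite addrC subrK.
  rewrite phiE; congr ((_ ^+ 2 + _ * _)%:E); first congr (_ - _);
    by apply: eq_Rintegral => x' _; rewrite phiE.
apply: le_integral_nonmeasurable => xs.
  by apply: integral_ge0 => xi _; apply: integral_ge0 => x _;
    rewrite lee_fin sqr_ge0.
apply: le_integral_nonmeasurable => xi.
  by apply: integral_ge0 => x _; rewrite lee_fin sqr_ge0.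
(* The bound |f| <= B holds for almost every query, so the clipping is dropped inside the query
   integral. *)
apply: ae_le_integral_nonmeasurable => [x|x||].
- by rewrite lee_fin sqr_ge0.
- by rewrite lee_fin sqr_ge0.
- apply/measurable_EFinP/measurable_funX/measurable_funB => //.
  apply: measurable_funM => //; apply: measurable_sum => k.
  apply: measurable_funM => //.
  exact: (measurableT_comp measurable_predictor (pair1_measurable (tnth xs k))).
- apply: filterS fB => x fxB; rewrite lee_fin /predictor/=.
  apply: le_trans (clip_contract _ fxB) _.
  rewrite le_eqVlt; apply/orP; left; apply/eqP.
  congr ((_ - _ * _) ^+ 2); apply: eq_bigr => k _.
  by rewrite tnth_mktuple predictor_dot.
Qed.

End fixed_window.

(** * Comparison with the target rate *)

Definition risk_constant (R : realType) (B C2 Cinf K kappa W : R) : R :=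
  (4 + 4 * kappa * W * C2 ^+ 2) + 4 * (1 + 2 * C2 ^+ 2 * kappa) * K
  + (8 * kappa * B ^+ 2 + 4 * kappa * W)
  + (16 * C2 * kappa * B ^+ 2 + 4 * kappa * W * C2 + 4 * kappa * W * Cinf ^+ 2).

(** Read [Nr] as N, [nr] as n, [x1] and [x2] as the logarithmic terms, [a2] as N^(-2s), [t ^+ 2] as
    N^2 delta^4 and [a4] as N^(2r+1) delta^2. The four summands of [risk_constant] are the
    coefficients of N/n, [a2], [t ^+ 2] and [a4]. Terms linear in [t] go to [a4], through [t <= a4]
    or the value of [t * L]. *)
Lemma risk_terms_le (R : realType)
    (B C2 Cinf K kappa W t L Nr nr x1 x2 a2 a4 : R) :
  0 <= C2 -> 0 <= K -> 0 <= kappa -> 0 <= W -> 0 <= t -> 0 <= Nr -> 1 <= nr ->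
  0 <= x1 -> 0 <= x2 -> 0 <= a2 -> t <= a4 -> t * L = Cinf ^+ 2 * a4 ->
  4 * (Nr / nr) +
  (4 * (K * a2 + 2 * C2 * kappa * (C2 * (K * a2) + t * B ^+ 2)
          + 2 * kappa * t * (C2 + t) * B ^+ 2)
   + W / nr * (2 * kappa * (C2 * (2 * C2 * Nr + 2 * t) + t * (2 * L + 2 * t))))
  <= risk_constant B C2 Cinf K kappa W
     * (x1 + x2 + Nr / nr + a2 + t ^+ 2 + a4).
Proof.
move=> C20 K0 kappa0 W0 t0 Nr0 nr1 x10 x20 a20 ta4 tL.
have nr0 : 0 < nr by apply: lt_le_trans nr1.
have nV1 : nr^-1 <= 1 by rewrite invf_le1.
have nV0 : 0 <= nr^-1 by rewrite invr_ge0 ltW.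
have a40 : 0 <= a4 := le_trans t0 ta4.
set a1 := Nr / nr; have a10 : 0 <= a1 by rewrite mulr_ge0.
have kW0 : 0 <= kappa * W by rewrite mulr_ge0.
have k1 : 0 <= 4 + 4 * kappa * W * C2 ^+ 2.
  by rewrite addr_ge0// !mulr_ge0.
have k2 : 0 <= 4 * (1 + 2 * C2 ^+ 2 * kappa) * K.
  by rewrite ?(sqr_ge0, addr_ge0, mulr_ge0).
have k3 : 0 <= 8 * kappa * B ^+ 2 + 4 * kappa * W.
  by rewrite ?(sqr_ge0, addr_ge0, mulr_ge0).
have k4 : 0 <= 16 * C2 * kappa * B ^+ 2 + 4 * kappa * W * C2
    + 4 * kappa * W * Cinf ^+ 2.
  by rewrite ?(sqr_ge0, addr_ge0, mulr_ge0).
have b1 : 16 * C2 * kappa * B ^+ 2 * t <= 16 * C2 * kappa * B ^+ 2 * a4.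
  by rewrite ler_wpM2l// ?(sqr_ge0, mulr_ge0).
have b2 : 4 * kappa * W * C2 * (t * nr^-1) <= 4 * kappa * W * C2 * a4.
  rewrite ler_wpM2l ?mulr_ge0//; apply: le_trans ta4.
  by rewrite ler_piMr.
have b3 : 4 * kappa * W * Cinf ^+ 2 * (a4 * nr^-1)
    <= 4 * kappa * W * Cinf ^+ 2 * a4.
  by rewrite ler_wpM2l ?(sqr_ge0, mulr_ge0)// ler_piMr.
have b4 : 4 * kappa * W * (t ^+ 2 * nr^-1) <= 4 * kappa * W * t ^+ 2.
  by rewrite ler_wpM2l ?mulr_ge0// ler_piMr// sqr_ge0.
apply: (@le_trans _ _ ((4 + 4 * kappa * W * C2 ^+ 2) * a1
  + 4 * (1 + 2 * C2 ^+ 2 * kappa) * K * a2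
  + (8 * kappa * B ^+ 2 + 4 * kappa * W) * t ^+ 2
  + (16 * C2 * kappa * B ^+ 2 + 4 * kappa * W * C2
      + 4 * kappa * W * Cinf ^+ 2) * a4)).
  have -> : W / nr * (2 * kappa *
      (C2 * (2 * C2 * Nr + 2 * t) + t * (2 * L + 2 * t))) =
      4 * kappa * W * C2 ^+ 2 * a1 + 4 * kappa * W * C2 * (t * nr^-1)
      + 4 * kappa * W * nr^-1 * (t * L) + 4 * kappa * W * (t ^+ 2 * nr^-1).
    by rewrite /a1; ring.
  by rewrite tL; lra.
rewrite /risk_constant.
move: k1 k2 k3 k4; set q1 := 4 + _; set q2 := _ * K; set q3 := 8 * _ * _ + _.
set q4 := 16 * _ * _ * _ + _ + _ => k1 k2 k3 k4.
set q := q1 + q2 + q3 + q4; set A := x1 + x2 + a1 + a2 + t ^+ 2 + a4.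
have t20 : 0 <= t ^+ 2 by rewrite sqr_ge0.
have A1 : a1 <= A by rewrite /A; lra.
have A2 : a2 <= A by rewrite /A; lra.
have A3 : t ^+ 2 <= A by rewrite /A; lra.
have A4 : a4 <= A by rewrite /A; lra.
have B1 := ler_wpM2l k1 A1; have B2 := ler_wpM2l k2 A2.
have B3 := ler_wpM2l k3 A3; have B4 := ler_wpM2l k4 A4.
rewrite /q; clearbody q1 q2 q3 q4 A; lra.
Qed.

(** * Averaging over the coefficients *)

Theorem proposition3p2 (R : realType) (d : nat) (X : set (d.-tuple R))
    (X0 : X !=set0)
    (PX : probability (domain X0) R) (Pbeta : probability (Rinfty R) R)
    (Pxi : probability R R)
    (psi : nat -> domain X0 -> R) (F : Rinfty R -> domain X0 -> R)
    (lo hi : nat -> nat) (sigma r C1 C2 Cinf s B C3 : R)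
    (hmodel : regression_model PX Pbeta Pxi psi F sigma)
    (h1 : assumption1 PX psi lo hi r C1 C2 Cinf)
    (h2 : assumption2 PX Pbeta psi F lo hi s B)
    (hC3 : C1^-1 <= C3) :
  exists2 C : R, 0 < C &
  forall (N n : nat) (FN : set (domain X0 -> 'cV[R]_N)) (B' delta : R)
    (phi_star : domain X0 -> 'cV[R]_N),
  (2 <= N)%N -> (1 <= n)%N ->
  assumption3 PX psi (lo N) FN B' delta phi_star ->
  let Risk := risk PX Pbeta Pxi F B n in
  let Theta_star :=
    (Gamma_star PX Pbeta psi (lo N) (hi N) N n, phi_star) in
  (ereal_inf [set Risk Theta | Theta in Gamma_class C3 N `*` FN] <= Risk Theta_star)%E
  /\
  (Risk Theta_star <=
    (C * (N%:R `^ (2 * r) / n%:R * ln N%:R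
          + N%:R `^ (4 * r) / n%:R ^+ 2 * ln N%:R ^+ 2
          + N%:R / n%:R
          + N%:R `^ (- 2 * s)
          + N%:R ^+ 2 * delta ^+ 4
          + N%:R `^ (2 * r + 1) * delta ^+ 2))%:E)%E.
Proof.
have [r0 C10 C20 Cinf0] := A1_constants h1.
have [s0 B0] := A2_constants h2.
have [K0 tail] := A2_tail h2.
(* The tail constant comes without a sign, but the estimates below need a nonnegative one. *)
pose K := Num.max K0 0.
have Kge0 : 0 <= K by rewrite le_max lexx orbT.
pose kappa := C1 ^- 2.
have kappa0 : 0 <= kappa by rewrite invr_ge0 sqr_ge0.
pose W := B ^+ 2 + sigma ^+ 2.
have W0 : 0 <= W by rewrite addr_ge0 ?sqr_ge0.
have psi2 := psi_L2 hmodel; have beta2 := beta_L2 hmodel.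
have mpsi j : measurable_fun setT (psi j).
  by have := sub_Lfun_mfun (psi2 j); rewrite inE.
have mbeta j : measurable_fun setT (fun b : Rinfty R => b j).
  by have := sub_Lfun_mfun (beta2 j); rewrite inE.
exists (risk_constant B C2 Cinf K kappa W).
  rewrite /risk_constant -!addrA ltr_wpDr//.
  by rewrite ?(sqr_ge0, addr_ge0, mulr_ge0) ?(ltW C20).
move=> N n FN B' delta phi_star N2 n0 h3 Risk Theta_star.
have [lo0 lohi hiN] := A1_window h1 N2.
have [B'0 delta0] := A3_constants h3.
have Nhi : (N <= hi N)%N by move: lo0 lohi hiN; clear; lia.
have hi2 : (2 <= hi N)%N := leq_trans N2 Nhi.
have [Sge Sle] := A1_Sigma h1 N2.
set S := Sigma_Psi PX psi (lo N) N in Sge Sle *.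
set Sb := Sigma_bar PX Pbeta psi (lo N) (hi N) N.
(* Ensures that [invmx Sb] is a true inverse, since [invmx] returns a singular matrix unchanged. *)
have Sbpd : pdmx Sb.
  exact: (Sigma_bar_pd lo0 lohi hiN (A1_independent h1 N2) (A1_span h1 N2)
    beta2 (A2_pd h2 N2)).
have Sgram : S = gram PX (psi_col psi (lo N) N) by exact: Sigma_Psi_gram.
have Ssym : S^T = S by rewrite Sgram gram_sym.
have Spsd : psdmx S.
  split=> // v; rewrite -lee_fin Sgram -integral_dot_gram.
    by apply: integral_ge0 => x _; rewrite lee_fin sqr_ge0.
  exact: psi_col_Lfun2.
pose A := S + n%:R^-1 *: invmx Sb.
have Sbinv := psdmx_inv (pdmx_psd Sbpd).
have Asym : A^T = A by rewrite linearD/= linearZ/= Ssym (psdmx_sym Sbinv).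
(* A >= S >= C1 puts [invmx A] below 1/C1 <= C3, hence in the class, and explains the value of
   [kappa]. *)
have Age v : C1 * dot v v <= quad A v.
  have : C1 * dot v v <= quad S v.
    have := Sge.2 v.
    by rewrite !quadE mulmxBl dotDr dotNr mul_scalar_mx dotZr subr_ge0.
  move=> /le_trans; apply; rewrite !quadE mulmxDl dotDr -scalemxAl dotZr lerDl.
  by rewrite mulr_ge0 ?invr_ge0// -quadE; exact: Sbinv.2.
have GE : Gamma_star PX Pbeta psi (lo N) (hi N) N n = invmx A by [].
have Au := coercive_unit C10 Age.
split.
  apply: ereal_inf_lbound; exists Theta_star => //; split.
    by rewrite /Theta_star GE; exact: (coercive_inv_loewner C10 Asym Age hC3).
  exact: (A3_mem h3).
pose eps := K * N%:R `^ (- 2 * s).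
pose L := (Cinf * N%:R `^ r) ^+ 2.
pose t := N%:R * delta ^+ 2.
pose c b := window_coef PX psi (lo N) (hi N) N b.
pose M := (1%:M - invmx A *m S)^T *m S *m (1%:M - invmx A *m S).
pose K2 := 4 * (eps + 2 * C2 * kappa * (C2 * eps + t * B ^+ 2)
                    + 2 * kappa * t * (C2 + t) * B ^+ 2)
  + W / n%:R * (2 * kappa * (C2 * (2 * C2 * N%:R + 2 * t) + t * (2 * L + 2 * t))).
have eps0 : 0 <= eps by rewrite mulr_ge0 ?powR_ge0.
have t0 : 0 <= t by rewrite mulr_ge0 ?sqr_ge0.
have K20 : 0 <= K2.
  have L0 : 0 <= L by rewrite sqr_ge0.
  have C2ge0 := ltW C20.
  by rewrite ?(sqr_ge0, addr_ge0, mulr_ge0, invr_ge0).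
have Mpsd : psdmx M by exact: psdmx_conj.
have psi_sup : {ae PX, forall x,
    \sum_(i < N) window psi (lo N) i x ^+ 2 <= L}.
  apply: filterS (Lnorm_oo_ae (poweR_half_le (Lnorm_ge0 _ _ _) (A1_sup h1 N2))).
  by move=> x; rewrite lee_fin => /(le_trans (ler_norm _)).
have conditional b : law_support Pbeta b ->
  (\int[iid_law PX n]_xs \int[iid_law Pxi n]_xi \int[PX]_x
    ((F b x - predictor B Theta_star xs (responses F b xs xi) x) ^+ 2)%:E
   <= (4 * quad M (c b) + K2)%:E)%E.
  move=> sb.
  have [T _ Tb] := window_coefE lo0 lohi hiN (A1_independent h1 N2) (A1_span h1 N2).
  have mF : measurable_fun setT (F b).
    exact: (measurableT_comp (F_measurable hmodel) (pair1_measurable b)).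
  have FB : {ae PX, forall x, `|F b x| <= B}.
    by apply: filterS (Lnorm_oo_ae (A2_bounded h2 sb)) => x; rewrite lee_fin.
  have mh : measurable_fun setT (partial_sum psi (hi N) b).
    by apply: measurable_sum => j; exact: measurable_funM.
  have hw : {ae PX, forall x, partial_sum psi (hi N) b x =
      window_sum psi (lo N) (c b) x}.
    by rewrite /c (Tb b).2; exact: (Tb b).1.
  (* The tail bound is taken at [hi N], where the partial sum is a window sum; as hi N >= N, it is
     at most the bound at N. *)
  have Fh : (\int[PX]_x ((F b x - partial_sum psi (hi N) b x) ^+ 2)%:E
      <= eps%:E)%E.
    rewrite -Lnorm2_sqr; apply: le_trans (tail _ hi2 _ sb) _.
    rewrite lee_fin; apply: (@le_trans _ _ (K * (hi N)%:R `^ (- 2 * s))).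
      by rewrite ler_wpM2r ?powR_ge0// le_max lexx.
    rewrite ler_wpM2l// mulNr !powRN lef_pV2 ?posrE ?powR_gt0 ?ltr0n//
      ?(ltnW N2) ?(ltnW hi2)//.
    by rewrite ge0_ler_powR ?nnegrE ?ler_nat// mulr_ge0// ltW.
  have := conditional_risk_le psi2 C20 Sle psi_sup (ltnW N2)
    (A3_measurable h3 (A3_mem h3)) (A3_bounded h3 (A3_mem h3)) delta0
    (A3_approx h3) mF FB mh hw Fh (xi_mean0 hmodel) (xi_bounded hmodel)
    (coercive_inv_sym Asym) (coercive_inv_norm C10 Age) kappa0 n0.
  refine (fun le => le_trans le _).
  by rewrite lee_fin /K2 -/S -/M -/t -/W -/kappa; lra.
have cLfun i : (fun b => c b i 0) \in Lfun Pbeta 2%:E.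
  exact: (window_coef_Lfun2 lo0 lohi hiN (A1_independent h1 N2) (A1_span h1 N2)
    beta2).
have mq : measurable_fun setT (fun b => quad M (c b)) by exact: measurable_quad.
have q0 b : 0 <= quad M (c b) by exact: Mpsd.2.
(* The conditional bound holds on the support of [Pbeta], hence almost surely. *)
apply: (@le_trans _ _ (\int[Pbeta]_b (4 * quad M (c b) + K2)%:E)%E).
  apply: ae_le_integral_nonmeasurable => [b|b||].
  - apply: integral_ge0 => xs _; apply: integral_ge0 => xi _.
    by apply: integral_ge0 => x _; rewrite lee_fin sqr_ge0.
  - by rewrite lee_fin addr_ge0// mulr_ge0.
  - by apply/measurable_EFinP/measurable_funD => //; exact: measurable_funM.
  - by apply: filterS (law_support_ae Pbeta mbeta) => b; exact: conditional.
have -> : (\int[Pbeta]_b (4 * quad M (c b) + K2)%:E = (4 * \tr (M *m Sb) + K2)%:E)%E.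
  under eq_integral do rewrite EFinD EFinM.
  rewrite ge0_integralD//; last 2 first.
  - by move=> b _; rewrite mule_ge0// lee_fin.
  - apply/measurable_funeM; exact/measurable_EFinP.
  rewrite integral_cst//= probability_setT mule1 ge0_integralZl//; last 2 first.
  - exact/measurable_EFinP.
  - by move=> b _; rewrite lee_fin.
  by rewrite integral_quad_gram// -EFinM -EFinD.
(* The ridge term of [Gamma_star] is the inverse of the very matrix [Sb] against which the bias is
   averaged. *)
have trM : \tr (M *m Sb) <= N%:R / n%:R.
  apply: ridge_trace_le => //.
  - by move=> Q; rewrite Sgram; apply: gram_trace_ge0; exact: psi_col_Lfun2.
  - by move=> Q; exact: gram_trace_ge0.
have N1 : 1 <= N%:R :> R by rewrite ler1n ltnW.
(* Used to bound [t], that is N delta^2, by N^(2r+1) delta^2. *)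
have Nr1 : 1 <= N%:R `^ (2 * r) :> R.
  by rewrite -[leLHS](powRr0 N%:R) ler_powR// mulr_ge0// ltW.
have pow2r1 : N%:R `^ (2 * r + 1) = N%:R `^ (2 * r) * N%:R :> R.
  rewrite powRD ?powRr1//; apply/implyP => _.
  by rewrite pnatr_eq0 -lt0n ltnW.
rewrite lee_fin; apply: (@le_trans _ _ (4 * (N%:R / n%:R) + K2)).
  by rewrite lerD2r ler_wpM2l.
rewrite (_ : N%:R ^+ 2 * delta ^+ 4 = t ^+ 2); last by rewrite /t; ring.
apply: risk_terms_le => //.
- exact: ltW.
- by rewrite ler1n.
- by rewrite mulr_ge0 ?divr_ge0 ?powR_ge0// ln_ge0.
- by rewrite mulr_ge0 ?divr_ge0 ?powR_ge0 ?sqr_ge0.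
- by rewrite pow2r1 /t ler_wpM2r ?sqr_ge0// ler_peMl.
- have Nr2 : (N%:R `^ r) ^+ 2 = N%:R `^ (2 * r) :> R.
    by rewrite -powR_mulrn ?powR_ge0// -powRrM mulrC.
  by rewrite pow2r1 /t /L exprMn Nr2; ring.
Qed.
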